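(* Let $T>0$, $1<p<\infty$, $0\leq\beta<1$, $p+\beta\leq2$ and $\omega\in A_p^+$. Let $G$ be a subset of $L^{p,\beta}_+((0,T),\omega)$. Then $G$ is a strongly pre-compact set in $L^{p,\beta}_+((0,T),\omega)$ if it satisfies the following conditions: (1) $G$ is uniformly bounded, i.e. $\sup_{f\in G}\|f\|_{L^{p,\beta}_+((0,T),\omega)}<\infty$; (2) $G$ is uniformly equicontinuous, i.e. $\sup_{f\in G}\|f(\cdot+l)-f(\cdot)\|_{L^{p,\beta}_+((0,T),\omega)}\rightarrow0$ as $l\rightarrow 0$; (3) $G$ uniformly vanishes at infinity, i.e. $\sup_{f\in G}\|f\chi_{E_{R}}\|_{L^{p,\beta}_+((0,T),\omega)}\rightarrow0$ as $R\rightarrow T$, where $E_{R}=\{x\in(0,T): x>R\}$.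
   Context: A weight $\omega$ is a positive function on $\mathbb{R}$; $p'$ is the conjugate exponent of $p$; $\chi_E$ is the characteristic function of $E$. Functions on $(0,T)$ are understood as extended by zero outside $(0,T)$ when translated. Strongly pre-compact means relatively compact in the norm topology. Weight class: for $1<p<\infty$, $\omega\in A_p^+$ means $$\sup_{a<b<c}\frac{1}{(c-a)^p}\int_a^b\omega(x)\,dx\Big(\int_b^c\omega(x)^{1-p'}\,dx\Big)^{p-1}<\infty.$$ Local one-sided weighted Morrey space: $L^{p,\beta}_+((0,T),\omega)$ consists of the functions $f$ on $(0,T)$ with $$\|f\|_{L^{p,\beta}_{+}((0,T),\omega)}=\sup_{0\leq x_0\leq T,\ 0<h\leq T}\Big(\frac{1}{h^{\beta-1}\int_{x_0-h}^{x_0}\omega(x)\,dx}\int_{(x_0,x_0+h)\cap(0,T)}|f(y)|^p\,dy\Big)^{1/p}<\infty.$$ *)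

(* Defs.v *)
From HB Require Import structures.
From mathcomp Require Import all_boot all_order all_algebra.
From mathcomp Require Import all_classical all_reals all_analysis.
From mathcomp Require Import measurable_realfun ring_quotient.

Set Implicit Arguments.
Unset Strict Implicit.
Unset Printing Implicit Defensive.
Import Order.TTheory GRing.Theory Num.Theory.
Import numFieldNormedType.Exports.

Local Open Scope classical_set_scope.
Local Open Scope ring_scope.

Record weight (R : realType) := Weight {
  weight_fun :> R -> R ;
  measurable_weight : measurable_fun [set: R] weight_fun ;
  weight_gt0 : forall x, 0 < weight_fun x }.

Definition Aplus (R : realType) (p : R) (omega : weight R) : Prop :=
  let p' := fine (hoelder_conjugate p%:E) in
  (ereal_sup [set z | exists a b c, [/\ (a < b)%R, (b < c)%R &
     z = (((c - a) `^ p)^-1)%:E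
         * \int[lebesgue_measure]_(x in `]a, b[) (omega x)%:E
         * (\int[lebesgue_measure]_(x in `]b, c[) (omega x `^ (1 - p'))%:E)
             `^ (p - 1)]]
   < +oo)%E.

(* Only the values of f on ]0, T[ matter. *)
Definition morrey_norm (R : realType) (T p beta : R) (omega : weight R)
    (f : R -> R) : \bar R :=
  (ereal_sup [set
     (((h `^ (beta - 1))%:E
         * \int[lebesgue_measure]_(x in `](x0 - h)%R, x0[) (omega x)%:E)^-1
      * \int[lebesgue_measure]_(y in `]x0, (x0 + h)%R[ `&` `]0%R, T[)
          (`|f y| `^ p)%:E) `^ p^-1
   | x0 in `[0%R, T] & h in `]0%R, T]])%E.

(* Supremum of nonnegative quantities: it is 0, not -oo, for the empty family. *)
Definition ereal_sup_ge0 (R : realType) (A : set (\bar R)) : \bar R :=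
  ereal_sup (0%E |` A).

Section seminorm.
Context (R : realType) (T p beta : R) (omega : weight R).
Hypotheses (T0 : 0 < T) (p1 : 1 < p).
Local Notation mu := (@lebesgue_measure R).
Let D x0 h : set R := `]x0, (x0 + h)[ `&` `]0, T[.
Let coef x0 h : \bar R := (((h `^ (beta - 1))%:E
   * \int[mu]_(x in `](x0 - h)%R, x0[) (omega x)%:E)^-1)%E.
Local Notation nm := (morrey_norm T p beta omega).

Let mD x0 h : measurable (D x0 h).
Proof. by apply: measurableI. Qed.

Let intw_ge0 x0 h : (0 <= \int[mu]_(x in `](x0 - h)%R, x0[) (omega x)%:E)%E.
Proof. by apply: integral_ge0 => x _; rewrite lee_fin ltW ?weight_gt0. Qed.

Let coef_ge0 x0 h : (0 <= coef x0 h)%E.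
Proof. by rewrite /coef inve_ge0 mule_ge0 ?lee_fin ?powR_ge0. Qed.

Let pn0 : p != 0. Proof. by rewrite gt_eqF// (lt_trans ltr01). Qed.

Let termE x0 h (f : R -> R) :
  ((coef x0 h * \int[mu]_(y in D x0 h) (`|f y| `^ p)%:E) `^ p^-1 =
   coef x0 h `^ p^-1 * 'N[mu]_p%:E[EFin \o (f \_ (D x0 h))])%E.
Proof.
have -> : ('N[mu]_p%:E[EFin \o (f \_ (D x0 h))] =
           (\int[mu]_(y in D x0 h) (`|f y| `^ p)%:E) `^ p^-1)%E.
  rewrite unlock [in RHS]integral_mkcond; congr (poweR _ _).
  apply: eq_integral => x _; rewrite /= /patch.
  by case: ifPn => // _; rewrite normr0 powR0.
apply: poweRM => //.
by apply: integral_ge0 => x _; rewrite lee_fin powR_ge0.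
Qed.

Let nm_term f x0 h : x0 \in `[0, T] -> h \in `]0, T] ->
  (coef x0 h `^ p^-1 * 'N[mu]_p%:E[EFin \o (f \_ (D x0 h))] <= nm f)%E.
Proof.
move=> x0T hT; apply: ereal_sup_ubound; exists x0 => //; exists h => //.
by rewrite -termE.
Qed.

Let nm_le f M : (forall x0 h, x0 \in `[0, T] -> h \in `]0, T] ->
  (coef x0 h `^ p^-1 * 'N[mu]_p%:E[EFin \o (f \_ (D x0 h))] <= M)%E) ->
  (nm f <= M)%E.
Proof.
move=> H; apply: ge_ereal_sup => _ [x0 x0T [h hT <-]].
by rewrite termE; exact: H.
Qed.

Let zT : 0 \in `[0, T]. Proof. by rewrite in_itv/= lexx ltW. Qed.
Let TT : T \in `]0, T]. Proof. by rewrite in_itv/= lexx T0. Qed.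

Lemma morrey_norm_ge0 f : (0 <= nm f)%E.
Proof.
by apply: le_trans (nm_term f zT TT); rewrite mule_ge0 ?poweR_ge0 ?Lnorm_ge0.
Qed.

Let mr x0 h (k : R -> R) : measurable_fun [set: R] k ->
  measurable_fun [set: R] (k \_ (D x0 h)).
Proof.
move=> mk; apply/(measurable_restrictT _ _).1 => //; exact: measurable_funS mk.
Qed.

Lemma ler_morrey_normD (f g : R -> R) :
  measurable_fun [set: R] f -> measurable_fun [set: R] g ->
  (nm (f \+ g)%R <= nm f + nm g)%E.
Proof.
move=> mf mg; apply: nm_le => x0 h x0T hT.
have -> : (f \+ g) \_ (D x0 h) = (f \_ (D x0 h)) \+ (g \_ (D x0 h)).
  by apply/funext => x; rewrite /= /patch; case: ifPn => //; rewrite addr0.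
apply: (@le_trans _ _ (coef x0 h `^ p^-1 * ('N[mu]_p%:E[EFin \o (f \_ (D x0 h))]
    + 'N[mu]_p%:E[EFin \o (g \_ (D x0 h))]))%E).
  apply: lee_wpmul2l; first exact: poweR_ge0.
  by apply: eminkowski; [exact: mr|exact: mr|rewrite lee_fin ltW].
rewrite ge0_muleDr ?Lnorm_ge0//.
by apply: leeD; exact: nm_term.
Qed.

Let LnormZ_ (a : R) (f : R -> R) : measurable_fun [set: R] f ->
  ('N[mu]_p%:E[EFin \o (a \*: f)] = `|a|%:E * 'N[mu]_p%:E[EFin \o f])%E.
Proof.
move=> mf; rewrite unlock.
under eq_integral do rewrite /= normrM powRM// EFinM.
rewrite ge0_integralZl_EFin ?powR_ge0//; last first.
  apply/measurable_EFinP.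
  apply: (@measurableT_comp _ _ _ _ _ _ (@powR R ^~ p)) => //.
  exact: measurableT_comp.
rewrite poweRM ?lee_fin ?powR_ge0//; last first.
  by apply: integral_ge0 => x _; rewrite lee_fin powR_ge0.
by rewrite poweR_EFin -powRrM mulfV// powRr1.
Qed.

Lemma morrey_normZ (a : R) (f : R -> R) : measurable_fun [set: R] f ->
  nm (a \*: f) = (`|a|%:E * nm f)%E.
Proof.
move=> mf; rewrite /morrey_norm -ereal_supZl//; last first.
  apply/set0P; eexists; exists 0; first exact: zT.
  by exists T; first exact: TT.
have E x0 h : ((coef x0 h * \int[mu]_(y in D x0 h)
      (`|a *: f y| `^ p)%:E) `^ p^-1 =
    `|a|%:E * (coef x0 h * \int[mu]_(y in D x0 h) (`|f y| `^ p)%:E) `^ p^-1)%E.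
  have L : ('N[mu]_p%:E[EFin \o ((a \*: f) \_ (D x0 h))] =
      `|a|%:E * 'N[mu]_p%:E[EFin \o (f \_ (D x0 h))])%E.
    rewrite -LnormZ_; last exact: mr.
    congr (Lnorm _ _ _); apply/funext => x /=; congr EFin.
    by rewrite /patch/=; case: ifPn => // _; rewrite scaler0.
  transitivity (coef x0 h `^ p^-1 * 'N[mu]_p%:E[EFin \o ((a \*: f) \_ (D x0 h))])%E.
    exact: (termE x0 h (a \*: f)).
  rewrite L muleCA; congr (mule _ _).
  exact: (esym (termE x0 h f)).
congr ereal_sup; apply/seteqP; split=> [_ [x0 x0T [h hT <-]]|].
  exists ((coef x0 h * \int[mu]_(y in D x0 h) (`|f y| `^ p)%:E) `^ p^-1)%E.
    by exists x0 => //; exists h.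
  by rewrite -E.
move=> _ [_ [x0 x0T [h hT <-]] <-]; exists x0 => //; exists h => //.
exact: E.
Qed.

Lemma eq_ae_morrey_norm (f g : R -> R) :
  measurable_fun [set: R] f -> measurable_fun [set: R] g ->
  {ae mu, forall x, x \in `]0, T[ -> f x = g x} -> nm f = nm g.
Proof.
have mp x0 h (k : R -> R) : measurable_fun [set: R] k ->
    measurable_fun (D x0 h) (fun y => (`|k y| `^ p)%:E).
  move=> mk; apply/measurable_EFinP; apply: (@measurable_funS _ _ _ _ setT) => //.
  apply: (@measurableT_comp _ _ _ _ _ _ (@powR R ^~ p)) => //.
  exact: measurableT_comp.
move=> mf mg fg.
have E x0 h : (\int[mu]_(y in D x0 h) (`|f y| `^ p)%:E =
               \int[mu]_(y in D x0 h) (`|g y| `^ p)%:E)%E.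
  apply: ge0_ae_eq_integral; [exact: mD|exact: mp|exact: mp| | |].
  - by move=> y _; rewrite lee_fin powR_ge0.
  - by move=> y _; rewrite lee_fin powR_ge0.
  - apply: filterS fg; first exact: (ae_filter_ringOfSetsType mu).
    by move=> x fgx [_ x0T]; rewrite fgx.
apply/eqP; rewrite eq_le; apply/andP; split; apply: nm_le => x0 h x0T hT.
  by rewrite -termE E termE; exact: nm_term.
by rewrite -termE -E termE; exact: nm_term.
Qed.

Lemma Aplus_int_weight_lty (a b : R) : Aplus p omega -> a < b ->
  (\int[mu]_(x in `]a, b[) (omega x)%:E < +oo)%E.
Proof.
move=> wA ab; rewrite ltey; apply/eqP => Ioo.
move: wA; rewrite /Aplus; set p' := fine _; apply/negP; rewrite -leNgt leye_eq.
rewrite -leye_eq.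
have bb1 : b < b + 1 by rewrite ltrDl.
set J := (\int[mu]_(x in `]b, (b + 1)%R[) (omega x `^ (1 - p'))%:E)%E.
have J0 : (0 <= J)%E by apply: integral_ge0 => x _; rewrite lee_fin powR_ge0.
suff Jgt0 : (0 < J)%E.
  apply: ereal_sup_ubound; exists a, b, (b + 1); split=> //.
  rewrite Ioo gt0_muley; last first.
    by rewrite lte_fin invr_gt0 powR_gt0// subr_gt0 (lt_trans ab).
  by rewrite gt0_mulye// poweR_gt0.
rewrite lt_neqAle J0 andbT eq_sym; apply/eqP => J00.
have mo : measurable_fun (`]b, b + 1[ : set R)
    (fun x => (omega x `^ (1 - p'))%:E).
  apply/measurable_EFinP; apply: (@measurable_funS _ _ _ _ setT) => //.
  apply: (@measurableT_comp _ _ _ _ _ _ (@powR R ^~ (1 - p'))) => //.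
  exact: measurable_weight.
have I0 : (\int[mu]_(x in `]b, (b + 1)%R[)
    `|(omega x `^ (1 - p'))%:E| = 0)%E.
  rewrite -[RHS]J00; apply: eq_integral => x _.
  by rewrite gee0_abs// lee_fin powR_ge0.
have [N [mN N0 sN]] := (ae_eq_integral_abs mu (measurable_itv _) mo).1 I0.
have : (mu `]b, (b + 1)%R[ <= mu N)%E.
  apply: le_measure; rewrite ?inE// => x bx; apply: sN => /= /(_ bx) [] /eqP.
  by rewrite powR_eq0 gt_eqF// weight_gt0.
by rewrite N0 lebesgue_measure_itv/= lte_fin bb1 -EFinD addrAC subrr add0r lee_fin ler10.
Qed.

Lemma morrey_norm_eq0 (f : R -> R) : Aplus p omega ->
  measurable_fun [set: R] f -> nm f = 0%E ->
  {ae mu, forall x, x \in `]0, T[ -> f x = 0}.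
Proof.
move=> wA mf nf0.
have := nm_term f zT TT; rewrite nf0 => t0.
have {t0} : (coef 0 T `^ p^-1 * 'N[mu]_p%:E[EFin \o (f \_ (D 0 T))] = 0)%E.
  by apply/eqP; rewrite eq_le t0 mule_ge0 ?poweR_ge0 ?Lnorm_ge0.
move=> /eqP; rewrite mule_eq0 => /orP[|/eqP].
  rewrite gt_eqF// poweR_gt0// lt_neqAle coef_ge0 andbT eq_sym inve_eq0 -ltey.
  rewrite lte_mul_pinfty ?lee_fin ?powR_ge0//.
  by apply: Aplus_int_weight_lty => //; rewrite gtrBl.
move=> /Lnorm_eq0_eq0; have /measurable_EFinP mfD := mr 0 T mf.
move=> /(_ mfD); rewrite lte_fin => /(_ (lt_trans ltr01 p1)).
move=> fD0; apply: (@filterS _ _ (ae_filter_ringOfSetsType mu) _ _ _ fD0).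
move=> x /(_ I) /= [] + x0T; rewrite /patch ifT// inE.
by split=> //; rewrite /= add0r.
Qed.

End seminorm.

(* The proof arguments make the space depend on the hypotheses that turn it
   into a normed space, as in [LfunType mu p1]. *)
Section morrey_fun.
Context (R : realType) (T p beta : R) (omega : weight R).

Definition finite_morrey (T0 : 0 < T) (p1 : 1 < p) : {pred {mfun R >-> R}} :=
  fun f => `[< (morrey_norm T p beta omega f < +oo)%E >].

Hypotheses (T0 : 0 < T) (p1 : 1 < p).

Lemma finite_morrey_submod_closed : submod_closed (finite_morrey T0 p1).
Proof.
split=> [|a f g /asboolP fi /asboolP gi]; apply/asboolP.
  have -> : (0 : {mfun R >-> R}) = 0 \*: (cst 0) :> (R -> R).
    by apply/funext => x /=; rewrite scale0r.
  by rewrite morrey_normZ// normr0 mul0e ltry.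
have mf : measurable_fun [set: R] (f : R -> R) by exact: measurable_funPT.
have mg : measurable_fun [set: R] (g : R -> R) by exact: measurable_funPT.
have maf : measurable_fun [set: R] (a \*: (f : R -> R)).
  exact: (measurable_funM (measurable_cst _) mf).
have -> : (a *: f + g : {mfun R >-> R}) = (a \*: (f : R -> R)) \+ g :> (R -> R).
  by [].
apply: le_lt_trans (ler_morrey_normD _ _ _ _ maf mg) _ => //.
apply: lte_add_pinfty; last exact: gi.
rewrite (morrey_normZ beta omega T0 p1 a mf).
apply: lte_mul_pinfty; [by rewrite lee_fin|by []|exact: fi].
Qed.

HB.instance Definition _ :=
  GRing.isSubmodClosed.Build R {mfun R >-> R} (finite_morrey T0 p1)
    finite_morrey_submod_closed.

Record morrey_fun := MorreyFun {
  morrey_mfun :> {mfun R >-> R} ;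
  _ : finite_morrey T0 p1 morrey_mfun }.

HB.instance Definition _ := [isSub for morrey_mfun].
HB.instance Definition _ := [Choice of morrey_fun by <:].
HB.instance Definition _ := [SubChoice_isSubLmodule of morrey_fun by <:].

Definition morrey_null : {pred morrey_fun} :=
  fun f => `[< {ae @lebesgue_measure R, forall x, x \in `]0, T[ -> f x = 0} >].

Lemma morrey_null_submod_closed : submod_closed morrey_null.
Proof.
have FF := ae_filter_ringOfSetsType (@lebesgue_measure R).
split=> [|a f g /asboolP f0 /asboolP g0]; apply/asboolP.
  by apply: (@filterE _ _ FF) => x.
apply: (@filterS2 _ _ FF _ _ _ _ f0 g0) => x fx gx xT.
have -> : (a *: f + g) x = a * f x + g x by [].
by rewrite fx// gx// addr0 mulr0.
Qed.

HB.instance Definition _ :=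
  GRing.isSubmodClosed.Build R morrey_fun morrey_null morrey_null_submod_closed.

End morrey_fun.

Section morrey.
Context (R : realType) (T p beta : R) (omega : weight R).
Local Open Scope quotient_scope.

Definition morrey (T0 : 0 < T) (p1 : 1 < p) (wA : Aplus p omega) : Type :=
  Quotient.quot (@morrey_null R T p beta omega T0 p1).

Variables (T0 : 0 < T) (p1 : 1 < p) (wA : Aplus p omega).
Local Notation V := (morrey T0 p1 wA).
Local Notation F := (morrey_fun beta omega T0 p1).
Local Notation nm := (morrey_norm T p beta omega).

HB.instance Definition _ := GRing.Zmodule.on V.
HB.instance Definition _ := EqQuotient.on V.

Let eq_pi (f g : F) : \pi_V f = \pi_V g <->
  {ae @lebesgue_measure R, forall x, x \in `]0, T[ -> f x = g x}.
Proof.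
have -> : (\pi_V f = \pi_V g) <-> (f - g \in @morrey_null R T p beta omega T0 p1).
  by rewrite Quotient.idealrBE; split=> /eqP.
have FF := ae_filter_ringOfSetsType (@lebesgue_measure R).
split=> [/asboolP H|H]; [|apply/asboolP];
    apply: (@filterS _ _ FF _ _ _ H) => x /[apply] /=.
  by move/subr0_eq.
by move=> fg; transitivity (f x - g x); [|rewrite fg subrr].
Qed.

Let piD (f g : F) : \pi_V (f + g) = \pi_V f + \pi_V g.
Proof. by rewrite piE. Qed.

Definition morrey_scale (a : R) (u : V) : V := \pi_V (a *: repr u).

Let pi_scale a (f : F) : morrey_scale a (\pi_V f) = \pi_V (a *: f).
Proof.
have FF := ae_filter_ringOfSetsType (@lebesgue_measure R).
apply/eq_pi; have /eq_pi H : \pi_V (repr (\pi_V f)) = \pi_V f by rewrite reprK.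
apply: (@filterS _ _ FF _ _ _ H) => x /[apply] fx.
transitivity (a * repr (\pi_V f) x); first by [].
by rewrite fx.
Qed.

Fact morrey_scaleA a b u :
  morrey_scale a (morrey_scale b u) = morrey_scale (a * b) u.
Proof.
rewrite -[u]reprK (pi_scale b) (pi_scale a) (pi_scale (a * b)).
by rewrite scalerA.
Qed.

Fact morrey_scale1 : left_id 1 morrey_scale.
Proof.
by move=> u; rewrite -[u]reprK !pi_scale scale1r.
Qed.

Fact morrey_scaleDr : right_distributive morrey_scale +%R.
Proof.
by move=> a u v; rewrite -[u]reprK -[v]reprK !pi_scale -!piD pi_scale scalerDr.
Qed.

Fact morrey_scaleDl u : {morph morrey_scale^~ u : a b / a + b}.
Proof.
by move=> a b; rewrite -[u]reprK !pi_scale -!piD scalerDl.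
Qed.

HB.instance Definition _ := GRing.Zmodule_isLmodule.Build R V
  morrey_scaleA morrey_scale1 morrey_scaleDr morrey_scaleDl.

(* A class seen as a function on the real line, extended by zero outside
   ]0, T[. *)
Definition fun_of_morrey (u : V) : R -> R :=
  (repr u : F) \_ (`]0, T[ : set R).

Lemma measurable_fun_of_morrey u : measurable_fun [set: R] (fun_of_morrey u).
Proof.
apply/(measurable_restrictT _ _).1; first exact: measurable_itv.
exact: measurable_funS (measurable_funPT _).
Qed.

Lemma fun_of_morrey_pi (f : F) : {ae @lebesgue_measure R,
  forall x, x \in `]0, T[ -> fun_of_morrey (\pi_V f) x = f x}.
Proof.
have FF := ae_filter_ringOfSetsType (@lebesgue_measure R).
have /eq_pi H : \pi_V (repr (\pi_V f)) = \pi_V f by rewrite reprK.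
apply: (@filterS _ _ FF _ _ _ H) => x fx xT.
by rewrite /fun_of_morrey /patch ifT ?inE// fx.
Qed.

Lemma morrey_norm_pi (f : F) : nm (fun_of_morrey (\pi_V f)) = nm f.
Proof.
apply: eq_ae_morrey_norm => //; first exact: measurable_fun_of_morrey.
exact: fun_of_morrey_pi.
Qed.

Lemma fun_of_morrey_lty u : (nm (fun_of_morrey u) < +oo)%E.
Proof.
rewrite -[u]reprK morrey_norm_pi.
exact: (asboolW (valP (repr u : F))).
Qed.

Definition fine_morrey_norm (u : V) : R := fine (nm (fun_of_morrey u)).

Let fine_morrey_normE u : (fine_morrey_norm u)%:E = nm (fun_of_morrey u).
Proof.
by rewrite fineK// ge0_fin_numE ?fun_of_morrey_lty ?morrey_norm_ge0.
Qed.

Let fine_morrey_norm_pi (f : F) : (fine_morrey_norm (\pi_V f))%:E = nm f.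
Proof. by rewrite fine_morrey_normE morrey_norm_pi. Qed.

Fact ler_fine_morrey_normD u v :
  fine_morrey_norm (u + v) <= fine_morrey_norm u + fine_morrey_norm v.
Proof.
rewrite -[u]reprK -[v]reprK; move: (repr u) (repr v) => f g.
rewrite -(piD f g).
have le_fine (x y z : R) (a b c : \bar R) :
    x%:E = a -> y%:E = b -> z%:E = c -> (a <= b + c)%E -> x <= y + z.
  by move=> <- <- <-; rewrite -EFinD lee_fin.
apply: (le_fine _ _ _ _ _ _ (fine_morrey_norm_pi (f + g))
  (fine_morrey_norm_pi f) (fine_morrey_norm_pi g)).
exact: (ler_morrey_normD T beta omega p1 (measurable_funPT f) (measurable_funPT g)).
Qed.

Fact fine_morrey_normZ a u :
  fine_morrey_norm (a *: u) = `|a| * fine_morrey_norm u.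
Proof.
rewrite -[u]reprK; move: (repr u) => f.
have -> : a *: (\pi_V f) = \pi_V (a *: f) := pi_scale a f.
have eq_fine (x y : R) (b c : \bar R) :
    x%:E = b -> y%:E = c -> (b = `|a|%:E * c)%E -> x = `|a| * y.
  by move=> <- <-; rewrite -EFinM => -[].
apply: (eq_fine _ _ _ _ (fine_morrey_norm_pi (a *: f)) (fine_morrey_norm_pi f)).
exact: (morrey_normZ beta omega T0 p1 a (measurable_funPT f)).
Qed.

Fact fine_morrey_norm_eq0 u : fine_morrey_norm u = 0 -> u = 0.
Proof.
rewrite -[u]reprK; move: (repr u) => f nf0.
have f0 : nm f = 0%E by rewrite -fine_morrey_norm_pi nf0.
have -> : 0 = \pi_V 0 :> V by rewrite piE.
apply/eq_pi; exact: (morrey_norm_eq0 T0 p1 wA (measurable_funPT f) f0).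
Qed.

HB.instance Definition _ := Lmodule_isNormed.Build R V
  ler_fine_morrey_normD fine_morrey_normZ fine_morrey_norm_eq0.

Lemma morrey_normE u : (`|u|)%:E = nm (fun_of_morrey u).
Proof. exact: fine_morrey_normE. Qed.

Lemma morrey_eqP (u v : V) : u = v <-> {ae @lebesgue_measure R,
  forall x, x \in `]0, T[ -> fun_of_morrey u x = fun_of_morrey v x}.
Proof.
split=> [-> //|H].
  by apply: (@filterE _ _ (ae_filter_ringOfSetsType (@lebesgue_measure R))).
have FF := ae_filter_ringOfSetsType (@lebesgue_measure R).
rewrite -[u]reprK -[v]reprK; apply/eq_pi.
apply: (@filterS _ _ FF _ _ _ H) => x uv xT.
have E (w : V) : fun_of_morrey w x = (repr w : F) x.
  by rewrite /fun_of_morrey /patch ifT ?inE.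
by rewrite -!E uv.
Qed.

Lemma morrey_exists (f : R -> R) :
  measurable_fun [set: R] f -> (nm f < +oo)%E ->
  exists u : V, {ae @lebesgue_measure R,
    forall x, x \in `]0, T[ -> fun_of_morrey u x = f x}.
Proof.
move=> mf fi; have fP : f \in mfun by exact: mem_set.
have gP : finite_morrey beta omega T0 p1 (mfun_Sub fP) by apply/asboolP; exact: fi.
by exists (\pi_V (MorreyFun gP)); exact: fun_of_morrey_pi.
Qed.

End morrey.

Coercion fun_of_morrey : morrey >-> Funclass.

(* Main.v *)
Require Import Defs.
From mathcomp Require Import all_boot all_order all_algebra.
From mathcomp Require Import all_classical all_reals all_analysis.
From mathcomp Require Import measurable_realfun ring lra.

Set Implicit Arguments.
Unset Strict Implicit.
Unset Printing Implicit Defensive.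
Import Order.TTheory GRing.Theory Num.Theory.
Import numFieldNormedType.Exports.

Local Open Scope classical_set_scope.
Local Open Scope ring_scope.

(** Kolmogorov-Riesz compactness in a weighted one-sided Morrey space.

    Precompactness is completeness of the space together with total boundedness
    of G ([precompact_totally_bounded]).

    Total boundedness ([morrey_totally_bounded]). Cut [0, T[ into N cells of
    length r and replace f by the step function of its means on the cells. By
    Jensen, Tonelli and translation invariance of the Lebesgue measure, the
    p-th power of the error on a window is at most twice the supremum, over
    |s| < r, of the integral of |f(x + s) - f(x)|^p on the same window; hence
    equicontinuity makes the error small in Morrey norm, uniformly over G
    ([morrey_norm_sub_step_le]). Boundedness of G makes the N means bounded, so
    they range over finitely many small boxes. It remains to see that step
    functions whose coefficients are in the same box are close in Morrey norm,
    that is, that bounded functions embed continuously in the Morrey space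
    ([morrey_norm_bounded]). This is where the weight enters: the A_p^+
    condition and Hoelder's inequality give w(x0 - h, x0) >= c h^p
    ([mass_ge_powR]), so a window of length h costs at most a constant times
    h^(2 - p - beta), and p + beta <= 2.

    Completeness ([morrey_fast_cauchy_cvg]). The norm controls the L^1 norm on
    ]0, T[, so a sequence with geometrically small steps converges almost
    everywhere ([fast_cauchy_ae_cvg]), and Fatou's lemma in each window carries
    the norm estimates to the limit ([fatou_powR]). *)

(** * Powers and Hoelder's inequality on a set *)

Section powers_and_hoelder.
Context {R : realType}.

Lemma poweRV_le (x : \bar R) (M p : R) : 0 < p -> (0 <= x)%E -> 0 <= M ->
  (x `^ p^-1 <= M%:E)%E = (x <= (M `^ p)%:E)%E.
Proof.
move=> p0 x0 M0; apply/idP/idP => H.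
  have := gt0_ler_poweR (ltW p0) _ _ H.
  rewrite -poweRrM mulVf ?gt_eqF// poweRe1// poweR_EFin; apply.
    by rewrite in_itv/= poweR_ge0 leey.
  by rewrite in_itv/= lee_fin M0 leey.
have pV0 : 0 <= p^-1 by rewrite invr_ge0 ltW.
have := gt0_ler_poweR pV0 _ _ H.
rewrite poweR_EFin -powRrM mulfV ?gt_eqF// powRr1//; apply.
  by rewrite in_itv/= x0 leey.
by rewrite in_itv/= lee_fin powR_ge0 leey.
Qed.

Lemma le_poweRV (x : \bar R) (M p : R) : 0 < p -> (0 <= x)%E -> 0 <= M ->
  (M%:E <= x `^ p^-1)%E = ((M `^ p)%:E <= x)%E.
Proof.
move=> p0 x0 M0; apply/idP/idP => H.
  have := gt0_ler_poweR (ltW p0) _ _ H.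
  rewrite -poweRrM mulVf ?gt_eqF// poweRe1// poweR_EFin; apply.
    by rewrite in_itv/= lee_fin M0 leey.
  by rewrite in_itv/= poweR_ge0 leey.
have pV0 : 0 <= p^-1 by rewrite invr_ge0 ltW.
have := gt0_ler_poweR pV0 _ _ H.
rewrite poweR_EFin -powRrM mulfV ?gt_eqF// powRr1//; apply.
  by rewrite in_itv/= lee_fin powR_ge0 leey.
by rewrite in_itv/= x0 leey.
Qed.

Lemma powR_gt0D (x r s : R) : 0 < x -> x `^ (r + s) = x `^ r * x `^ s.
Proof. by move=> x0; apply: powRD; apply/implyP => _; rewrite gt_eqF. Qed.

Lemma measurable_fun_normr_powR d (S : measurableType d) (D : set S)
    (g : S -> R) (p : R) :
  measurable_fun D g -> measurable_fun D (fun y => (`|g y| `^ p)%:E).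
Proof.
move=> mg; apply/measurable_EFinP.
apply: (@measurableT_comp _ _ _ _ _ _ (@powR R ^~ p)) => //.
exact: measurableT_comp.
Qed.

(** Hoelder's inequality for functions cut off to a set. The integrals may be
    infinite, which matters below: the integrability of the dual weight is not
    known beforehand. *)
Lemma hoelder_on d (S : measurableType d) (mu : {measure set S -> \bar R})
    (A : set S) (f g : S -> R) (p q : R) :
  measurable A -> measurable_fun [set: S] f -> measurable_fun [set: S] g ->
  0 < p -> 0 < q -> p^-1 + q^-1 = 1 ->
  (\int[mu]_(x in A) `|f x * g x|%:E <=
     (\int[mu]_(x in A) (`|f x| `^ p)%:E) `^ p^-1 *
     (\int[mu]_(x in A) (`|g x| `^ q)%:E) `^ q^-1)%E.
Proof.
move=> mA mf mg p0 q0 pq.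
have mr (k : S -> R) : measurable_fun [set: S] k ->
    measurable_fun [set: S] (k \_ A).
  move=> mk; apply/(measurable_restrictT _ _).1 => //.
  exact: measurable_funS mk.
have nE (k : S -> R) (r : R) : r != 0 ->
    ('N[mu]_r%:E[EFin \o (k \_ A)] =
      (\int[mu]_(x in A) (`|k x| `^ r)%:E) `^ r^-1)%E.
  move=> r0; rewrite unlock [in RHS]integral_mkcond; congr (poweR _ _).
  apply: eq_integral => x _; rewrite /= /patch.
  by case: ifPn => // _; rewrite normr0 powR0.
have := hoelder mu (mr _ mf) (mr _ mg) p0 q0 pq.
rewrite !nE ?gt_eqF//; apply: le_trans.
rewrite Lnorm1 [leLHS]integral_mkcond; apply: ge0_le_integral => //=.
- by move=> x _; rewrite /patch; case: ifPn.
- apply/(measurable_restrictT _ _).1 => //.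
  apply: (@measurable_funS _ _ _ _ [set: S]) => //.
  apply/measurable_EFinP; apply: measurableT_comp => //.
  exact: (measurable_funM mf mg).
- apply/measurable_EFinP; apply: measurableT_comp => //.
  exact: (measurable_funM (mr _ mf) (mr _ mg)).
by move=> x _; rewrite /patch; case: ifPn => // _; rewrite mulr0 normr0.
Qed.

Lemma conj_exp (p : R) : 1 < p -> p^-1 + (p / (p - 1))^-1 = 1.
Proof.
move=> p1; have p0 : p != 0 by rewrite gt_eqF// (lt_trans ltr01).
by rewrite invf_div; field.
Qed.

(** Hoelder against the constant 1. *)
Lemma integral_norm_le d (S : measurableType d) (mu : {measure set S -> \bar R})
    (A : set S) (f : S -> R) (p : R) :
  measurable A -> measurable_fun [set: S] f -> 1 < p ->
  (\int[mu]_(x in A) `|f x|%:E <=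
     (\int[mu]_(x in A) (`|f x| `^ p)%:E) `^ p^-1 * mu A `^ (1 - p^-1))%E.
Proof.
move=> mA mf p1; have p0 : 0 < p by rewrite (lt_trans ltr01).
have q0 : 0 < p / (p - 1) by rewrite divr_gt0 ?subr_gt0.
have := hoelder_on mu mA mf (measurable_cst (1 : R)) p0 q0 (conj_exp p1).
under eq_integral do rewrite mulr1.
under [X in (_ <= _ * X `^ _)%E -> _]eq_integral do rewrite normr1 powR1.
rewrite integral_cst// mul1e.
suff -> : (p / (p - 1))^-1 = 1 - p^-1 by [].
by apply: (addrI p^-1); rewrite conj_exp// addrC subrK.
Qed.

End powers_and_hoelder.

(** * Masses of intervals for an A_p^+ weight *)

Section one_sided_weights.
Context {R : realType}.
Local Notation mu := (@lebesgue_measure R).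

Definition mass (omega : weight R) (a b : R) : R :=
  fine (\int[mu]_(x in `]a, b[) (omega x)%:E).

Lemma integral_pos_gt0 (f : R -> R) (a b : R) : a < b ->
  measurable_fun [set: R] f -> (forall x, 0 < f x) ->
  (0 < \int[mu]_(x in `]a, b[) (f x)%:E)%E.
Proof.
move=> ab mf f0.
have J0 : (0 <= \int[mu]_(x in `]a, b[) (f x)%:E)%E.
  by apply: integral_ge0 => x _; rewrite lee_fin ltW.
rewrite lt_neqAle J0 andbT eq_sym; apply/eqP => J00.
have mo : measurable_fun (`]a, b[ : set R) (EFin \o f).
  by apply/measurable_EFinP; exact: measurable_funS mf.
have I0 : (\int[mu]_(x in `]a, b[) `|(EFin \o f) x| = 0)%E.
  rewrite -[RHS]J00; apply: eq_integral => x _.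
  by rewrite gee0_abs//= lee_fin ltW.
have [N [mN N0 sN]] := (ae_eq_integral_abs mu (measurable_itv _) mo).1 I0.
have : (mu `]a, b[ <= mu N)%E.
  apply: le_measure; rewrite ?inE// => x abx; apply: sN => /= /(_ abx) [] /eqP.
  by rewrite gt_eqF.
by rewrite N0 lebesgue_measure_itv/= lte_fin ab -EFinD lee_fin leNgt
  subr_gt0 ab.
Qed.

Context {p : R} {omega : weight R}.
Hypotheses (p1 : 1 < p) (wA : Aplus p omega).

Lemma massE (a b : R) : a < b ->
  (\int[mu]_(x in `]a, b[) (omega x)%:E = (mass omega a b)%:E)%E.
Proof.
move=> ab; rewrite /mass fineK// ge0_fin_numE; last first.
  by apply: integral_ge0 => x _; rewrite lee_fin ltW ?weight_gt0.
exact: (Aplus_int_weight_lty wA).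
Qed.

Lemma mass_gt0 (a b : R) : a < b -> 0 < mass omega a b.
Proof.
move=> ab; rewrite -lte_fin -massE//; apply: integral_pos_gt0 => //.
  exact: measurable_weight.
exact: weight_gt0.
Qed.

Lemma le_mass (a b c d : R) : c <= a -> a < b -> b <= d ->
  mass omega a b <= mass omega c d.
Proof.
move=> ca ab bd; rewrite -lee_fin -!massE//; last first.
  exact: le_lt_trans ca (lt_le_trans ab bd).
apply: ge0_subset_integral => //.
- apply/measurable_EFinP;
  by apply: measurable_funS (measurable_weight omega).
- by move=> x _; rewrite lee_fin ltW ?weight_gt0.
by apply: subset_itv; rewrite bnd_simp.
Qed.

(** The A_p^+ supremum as one real constant, with the exponent 1 - p' of the
    dual weight in the explicit form - 1 / (p - 1). *)
Lemma Aplus_bound : exists2 K : R, 0 < K & forall a b c, a < b -> b < c ->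
  ((mass omega a b)%:E *
   (\int[mu]_(x in `]b, c[) (omega x `^ (- (p - 1)^-1))%:E) `^ (p - 1)
   <= (K * (c - a) `^ p)%:E)%E.
Proof.
move: (wA); rewrite /Aplus.
have -> : 1 - fine (hoelder_conjugate p%:E) = - (p - 1)^-1.
  rewrite /hoelder_conjugate/= eqe gt_eqF ?(lt_trans ltr01)// -EFinD inver.
  rewrite subr_eq0 gt_eqF// -EFinM/=.
  have : p - 1 != 0 by rewrite subr_eq0 gt_eqF.
  by move=> ?; field.
set S := [set z | _]; move=> Soo.
have [K [K0 SK]] : exists K : R, 0 < K /\ (ereal_sup S <= K%:E)%E.
  case: (ereal_sup S) Soo => [r _| |] //.
    exists (Num.max r 1); rewrite lt_max ltr01 orbT; split => //.
    by rewrite lee_fin le_max lexx.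
  by exists 1; rewrite ltr01 leNye.
exists K => // a b c ab bc.
have ac : a < c by exact: lt_trans bc.
have : ((((c - a) `^ p)^-1)%:E
         * \int[mu]_(x in `]a, b[) (omega x)%:E
         * (\int[mu]_(x in `]b, c[) (omega x `^ (- (p - 1)^-1))%:E)
             `^ (p - 1) <= K%:E)%E.
  by apply: le_trans SK; apply: ereal_sup_ubound; exists a, b, c.
rewrite massE// -muleA lee_pdivrMl ?powR_gt0 ?subr_gt0//.
by rewrite -EFinM mulrC.
Qed.

(** For E = ]x0 - h, x0[, Hoelder applied to 1 = w^(1/p) w^(-1/p) gives
    h^p <= w(E) s(E)^(p - 1), where s is the dual weight; and the A_p^+
    condition for the adjacent intervals ]- T - 1, x0 - h[ and E bounds
    s(E)^(p - 1), because the left one always contains ]- T - 1, - T[, whose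
    mass does not depend on x0 and h. *)
Lemma mass_ge_powR (T : R) : 0 < T -> exists2 c : R, 0 < c &
  forall x0 h, 0 <= x0 -> x0 <= T -> 0 < h -> h <= T ->
    c * h `^ p <= mass omega (x0 - h) x0.
Proof.
move=> T0; have [K K0 AK] := Aplus_bound.
have p0 : 0 < p by rewrite (lt_trans ltr01).
have pm1 : 0 < p - 1 by rewrite subr_gt0.
have q0 : 0 < p / (p - 1) by rewrite divr_gt0.
set m := mass omega (- T - 1) (- T).
have m0 : 0 < m by apply: mass_gt0; rewrite gtrBl.
set L := K * (2 * T + 1) `^ p.
have L0 : 0 < L by rewrite mulr_gt0// powR_gt0//; lra.
exists (m / L); first by rewrite divr_gt0.
move=> x0 h x00 x0T h0 hT.
set w := mass omega (x0 - h) x0.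
have xh : x0 - h < x0 by rewrite gtrBl.
have w0 : 0 < w by exact: mass_gt0.
have := AK (- T - 1) (x0 - h) x0 _ xh.
set J := (\int[mu]_(x in _) _)%E => /(_ ltac:(lra)) HJ.
have J0 : (0 <= J)%E by apply: integral_ge0 => x _; rewrite lee_fin powR_ge0.
have mJ : (m%:E * J `^ (p - 1) <= L%:E)%E.
  apply: (@le_trans _ _ ((mass omega (- T - 1) (x0 - h))%:E * J `^ (p - 1))%E).
    apply: lee_wpmul2r; first exact: poweR_ge0.
    by rewrite lee_fin; apply: le_mass; lra.
  apply: (le_trans HJ); rewrite lee_fin ler_wpM2l// ?(ltW K0)//.
  by apply: ge0_ler_powR; rewrite ?nnegrE; lra.
have Jle : (J `^ (p - 1) <= (L / m)%:E)%E.
  by rewrite mulrC EFinM lee_pdivlMl.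
have hJ : (h%:E <= w%:E `^ p^-1 * J `^ (p / (p - 1))^-1)%E.
  have := @hoelder_on _ _ _ mu `]x0 - h, x0[ (fun x => omega x `^ p^-1)
    (fun x => omega x `^ (- p^-1)) p (p / (p - 1)).
  have mw r : measurable_fun [set: R] (fun x => omega x `^ r).
    apply: (@measurableT_comp _ _ _ _ _ _ (@powR R ^~ r)) => //.
    exact: measurable_weight.
  move=> /(_ (measurable_itv _) (mw _) (mw _) p0 q0 (conj_exp p1)).
  under eq_integral.
    move=> x _; rewrite -powR_gt0D ?weight_gt0//.
    rewrite subrr powRr0 normr1; over.
  rewrite integral_cst//= mul1e lebesgue_measure_itv/= lte_fin xh -EFinD.
  rewrite opprB addrCA subrr addr0.
  under [X in (_ <= X `^ _ * _)%E -> _]eq_integral.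
    move=> x _; rewrite ger0_norm ?powR_ge0// -powRrM mulVf ?gt_eqF//.
    rewrite powRr1 ?ltW ?weight_gt0//; over.
  rewrite massE//.
  under [X in (_ <= _ * X `^ _)%E -> _]eq_integral.
    move=> x _; rewrite ger0_norm ?powR_ge0// -powRrM mulNr mulrA.
    rewrite mulVf ?gt_eqF// mul1r; over.
  by [].
have hw : h `^ p <= w * (L / m).
  have : (h%:E `^ p <= (w%:E `^ p^-1 * J `^ (p / (p - 1))^-1) `^ p)%E.
    apply: (gt0_ler_poweR (ltW p0)) => //.
      by rewrite in_itv/= leey andbT lee_fin ltW.
    by rewrite in_itv/= leey andbT mule_ge0// ?poweR_ge0// lee_fin powR_ge0.
  rewrite poweRM ?poweR_ge0// -!poweRrM mulVf ?gt_eqF//.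
  rewrite poweRe1 ?lee_fin; last exact: ltW.
  have -> : (p / (p - 1))^-1 * p = p - 1.
    by rewrite invf_div mulfVK// gt_eqF.
  rewrite -lee_fin EFinM -poweR_EFin => /le_trans; apply.
  by apply: lee_wpmul2l => //; rewrite lee_fin ltW.
rewrite mulrAC ler_pdivrMr// -ler_pdivlMl// (le_trans hw)//.
by rewrite mulrA [leRHS]mulrC.
Qed.

End one_sided_weights.

(** * Estimates for the Morrey norm *)

Section morrey_norm_bounds.
Context {R : realType} {T p beta : R} {omega : weight R}.
Hypotheses (T0 : 0 < T) (p1 : 1 < p) (wA : Aplus p omega).
Local Notation mu := (@lebesgue_measure R).
Local Notation nm := (morrey_norm T p beta omega).

Definition window (T x0 h : R) : set R := `]x0, (x0 + h)[ `&` `]0, T[.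

Lemma measurable_window x0 h : measurable (window T x0 h).
Proof. by apply: measurableI. Qed.

(** Clearing denominators turns a bound on the supremum into a family of plain
    integral inequalities, one for each window; all the estimates below are
    made in this form. The masses are finite and positive because the weight
    is in A_p^+. *)
Lemma morrey_normP (f : R -> R) (M : R) : 0 <= M ->
  (nm f <= M%:E)%E <->
  (forall x0 h, 0 <= x0 -> x0 <= T -> 0 < h -> h <= T ->
    (\int[mu]_(y in window T x0 h) (`|f y| `^ p)%:E <=
       (M `^ p * (h `^ (beta - 1) * mass omega (x0 - h) x0))%:E)%E).
Proof.
move=> M0; have p0 : 0 < p by rewrite (lt_trans ltr01).
have step x0 h : 0 < h ->
    ((((h `^ (beta - 1))%:E
         * \int[mu]_(x in `](x0 - h)%R, x0[) (omega x)%:E)^-1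
      * \int[mu]_(y in window T x0 h) (`|f y| `^ p)%:E) `^ p^-1 <= M%:E)%E =
    (\int[mu]_(y in window T x0 h) (`|f y| `^ p)%:E <=
       (M `^ p * (h `^ (beta - 1) * mass omega (x0 - h) x0))%:E)%E.
  move=> h0; have xh : x0 - h < x0 by rewrite gtrBl.
  have w0 := mass_gt0 wA xh.
  have hw0 : 0 < h `^ (beta - 1) * mass omega (x0 - h) x0.
    by rewrite mulr_gt0 ?powR_gt0.
  rewrite (massE wA)// -EFinM inver gt_eqF//.
  rewrite poweRV_le//; last first.
    rewrite mule_ge0//; first by rewrite lee_fin invr_ge0 ltW.
    by apply: integral_ge0 => x _; rewrite lee_fin powR_ge0.
  by rewrite lee_pdivrMl// -EFinM mulrC.
split=> [H x0 h x00 x0T h0 hT|H].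
  rewrite -step//; apply: le_trans H; apply: ereal_sup_ubound.
  exists x0 => /=; first by rewrite in_itv/= x00.
  by exists h => //=; rewrite in_itv/= h0.
apply: ge_ereal_sup => _ [x0 /= + [h /= + <-]].
rewrite !in_itv/= => /andP[x00 x0T] /andP[h0 hT].
by rewrite -/(window T x0 h) step//; exact: H.
Qed.

Lemma integral_powR_le (f : R -> R) (M : R) : 0 <= M -> (nm f <= M%:E)%E ->
  (\int[mu]_(y in `]0%R, T[) (`|f y| `^ p)%:E <=
    (M `^ p * (T `^ (beta - 1) * mass omega (- T) 0))%:E)%E.
Proof.
move=> M0 /(morrey_normP f M0)/(_ 0 T (lexx _) (ltW T0) T0 (lexx _)).
by rewrite /window add0r setIid sub0r.
Qed.

(** A bound for the norm of the inclusion of the Morrey space in L^1(]0, T[):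
    the window x0 = 0, h = T controls the L^p norm, and Hoelder the L^1 norm. *)
Definition L1const : R :=
  (T `^ (beta - 1) * mass omega (- T) 0) `^ p^-1 * T `^ (1 - p^-1).

Lemma L1const_ge0 : 0 <= L1const.
Proof. by rewrite mulr_ge0 ?powR_ge0. Qed.

Lemma integral_norm_morrey (f : R -> R) (M : R) : 0 <= M ->
  measurable_fun [set: R] f -> (nm f <= M%:E)%E ->
  (\int[mu]_(y in `]0%R, T[) `|f y|%:E <= (M * L1const)%:E)%E.
Proof.
move=> M0 mf fM; have p0 : 0 < p by rewrite (lt_trans ltr01).
apply: (le_trans (integral_norm_le mu (measurable_itv `]0, T[) mf p1)).
have muT : mu `]0, T[ = T%:E.
  by rewrite lebesgue_measure_itv/= lte_fin T0 oppr0 adde0.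
rewrite [X in (_ * X `^ _)%E](_ : _ = T%:E)//.
rewrite poweR_EFin /L1const mulrA EFinM; apply: lee_wpmul2r.
  by rewrite lee_fin powR_ge0.
have m0 : 0 < mass omega (- T) 0 by rewrite (mass_gt0 wA)// oppr_lt0.
have hw0 : 0 <= T `^ (beta - 1) * mass omega (- T) 0.
  by rewrite mulr_ge0 ?powR_ge0 ?ltW.
rewrite poweRV_le//; last 2 first.
- by apply: integral_ge0 => x _; rewrite lee_fin powR_ge0.
- by rewrite mulr_ge0 ?powR_ge0.
rewrite powRM ?powR_ge0// -[X in (_ * X)%:E]powRrM mulVf ?gt_eqF// powRr1//.
exact: integral_powR_le.
Qed.

(** For a function bounded by M the integral over a window is at
    most M^p h, while the weighted size of the window is at least
    c h^(beta - 1 + p); the quotient is of order h^(2 - p - beta), which is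
    bounded near h = 0 exactly when p + beta <= 2. *)
Lemma morrey_norm_bounded : p + beta <= 2 -> exists2 K : R, 0 < K &
  forall (g : R -> R) (M : R), measurable_fun [set: R] g -> 0 <= M ->
    (forall x, 0 < x -> x < T -> `|g x| <= M) -> (nm g <= (K * M)%:E)%E.
Proof.
move=> pb; have p0 : 0 < p by rewrite (lt_trans ltr01).
have [c c0 cm] := mass_ge_powR p1 wA T0.
exists ((T `^ (2 - p - beta) / c) `^ p^-1).
  by rewrite powR_gt0 ?divr_gt0 ?powR_gt0.
move=> g M mg M0 gM; apply/morrey_normP; first by rewrite mulr_ge0 ?powR_ge0.
move=> x0 h x00 x0T h0 hT.
apply: (@le_trans _ _ (\int[mu]_(y in window T x0 h) (M `^ p)%:E)%E).
  apply: ge0_le_integral => //.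
  - exact: measurable_window.
  - apply: measurable_fun_normr_powR; exact: measurable_funS mg.
  move=> y [_]; rewrite /= in_itv/= => /andP[y0 yT].
  by rewrite lee_fin ge0_ler_powR ?nnegrE ?(ltW p0)//; exact: gM.
rewrite integral_cst; last exact: measurable_window.
apply: (@le_trans _ _ ((M `^ p)%:E * h%:E)%E).
  apply: lee_wpmul2l; first by rewrite lee_fin powR_ge0.
  apply: (@le_trans _ _ (mu `]x0, x0 + h[)).
    apply: le_measure; rewrite ?inE//; last by move=> y [].
    exact: measurable_window.
  by rewrite lebesgue_measure_itv/= lte_fin ltrDl h0 -EFinD addrAC subrr add0r.
rewrite -EFinM lee_fin powRM ?powR_ge0// -powRrM mulVf ?gt_eqF//.
rewrite powRr1 ?divr_ge0 ?powR_ge0 ?(ltW c0)//.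
set A := T `^ (2 - p - beta).
rewrite [leRHS]mulrAC [leRHS]mulrC ler_wpM2l ?powR_ge0//.
apply: (@le_trans _ _ (A / c * (h `^ (beta - 1) * (c * h `^ p)))); last first.
  by rewrite ler_wpM2l ?divr_ge0 ?powR_ge0 ?(ltW c0)// ler_wpM2l ?powR_ge0 ?cm.
have -> : A / c * (h `^ (beta - 1) * (c * h `^ p)) = A * h `^ (beta - 1 + p).
  by rewrite [X in _ = _ * X]powR_gt0D//; field; rewrite gt_eqF.
have E : h = h `^ (2 - p - beta) * h `^ (beta - 1 + p).
  rewrite -powR_gt0D//.
  by rewrite (_ : _ + _ = 1) ?powRr1 ?ltW//; ring.
rewrite {1}E ler_wpM2r ?powR_ge0//.
rewrite ge0_ler_powR ?nnegrE ?(ltW h0) ?(ltW T0)//; lra.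
Qed.

End morrey_norm_bounds.

(** * Means, Tonelli on a product of sets, and translations *)

Section averages_and_translations.
Context {R : realType}.

(** Jensen's inequality for t |-> t^p, obtained from Hoelder so that the right
    side may be infinite. *)
Lemma powR_average_le d (S : measurableType d) (mu : {measure set S -> \bar R})
    (A : set S) (f : S -> R) (p r a : R) :
  measurable A -> measurable_fun [set: S] f -> mu.-integrable A (EFin \o f) ->
  1 < p -> 0 < r -> mu A = r%:E ->
  ((`|a - r^-1 * \int[mu]_(y in A) f y| `^ p)%:E <=
    (r^-1)%:E * \int[mu]_(y in A) (`|a - f y| `^ p)%:E)%E.
Proof.
move=> mA mf intf p1 r0 muA; have p0 : 0 < p by rewrite (lt_trans ltr01).
have inta : mu.-integrable A (EFin \o cst a).
  apply/integrableP; split.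
    by apply/measurable_EFinP; exact: measurable_cst.
  rewrite (eq_integral (cst `|a|%:E))//= integral_cst// muA -EFinM.
  exact: ltry.
have mg : measurable_fun [set: S] (fun y => a - f y).
  exact: (measurable_funB (measurable_cst _) mf).
have intg : mu.-integrable A (EFin \o (fun y => a - f y)).
  exact: (integrableB mA inta intf).
have -> : a - r^-1 * \int[mu]_(y in A) f y =
    r^-1 * \int[mu]_(y in A) (a - f y).
  rewrite RintegralB// Rintegral_cst// muA/=; field; exact: lt0r_neq0.
rewrite normrM gtr0_norm ?invr_gt0//.
set X := (\int[mu]_(y in A) _)%E.
have X0 : (0 <= X)%E by apply: integral_ge0 => y _; rewrite lee_fin powR_ge0.
set I := \int[mu]_(y in A) _.
have HI : (`|I|%:E <= X `^ p^-1 * (r `^ (1 - p^-1))%:E)%E.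
  rewrite -poweR_EFin -muA; apply: le_trans (integral_norm_le mu mA mg p1).
  have : (`|\int[mu]_(y in A) (a - f y)%:E| <=
      \int[mu]_(y in A) `|(a - f y)%:E|)%E.
    apply: le_abse_integral => //; exact: (measurable_int _ intg).
  have -> : (\int[mu]_(y in A) (a - f y)%:E)%E = I%:E.
    by rewrite fineK//; exact: integrable_fin_num.
  by [].
rewrite -le_poweRV ?mulr_ge0 ?invr_ge0 ?(ltW r0)//; last first.
  by rewrite mule_ge0// lee_fin invr_ge0 ltW.
rewrite poweRM ?lee_fin ?invr_ge0 ?(ltW r0)// poweR_EFin.
have -> : r^-1 `^ p^-1 = r^-1 * r `^ (1 - p^-1).
  rewrite -{1}(powR_inv1 (ltW r0)) -powRrM mulN1r.
  by rewrite powR_gt0D// powRr1 ?(ltW r0)// mulKf ?gt_eqF.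
rewrite !EFinM -muleA; apply: lee_wpmul2l.
  by rewrite lee_fin invr_ge0 ltW.
by rewrite muleC.
Qed.

Lemma fubini_tonelli_on d1 d2 (S1 : measurableType d1) (S2 : measurableType d2)
    (m1 : {sigma_finite_measure set S1 -> \bar R})
    (m2 : {sigma_finite_measure set S2 -> \bar R})
    (A : set S1) (B : set S2) (f : S1 * S2 -> \bar R) :
  measurable A -> measurable B -> measurable_fun [set: S1 * S2] f ->
  (forall z, 0 <= f z)%E ->
  (\int[m1]_(x in A) \int[m2]_(y in B) f (x, y) =
   \int[m2]_(y in B) \int[m1]_(x in A) f (x, y))%E.
Proof.
move=> mA mB mf f0.
have mF : measurable_fun [set: S1 * S2] (f \_ (A `*` B)).
  apply/(measurable_restrictT _ _).1; first exact: measurableX.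
  exact: measurable_funS mf.
have F0 z : (0 <= (f \_ (A `*` B)) z)%E by rewrite /patch; case: ifPn.
transitivity (\int[m1]_x \int[m2]_y (f \_ (A `*` B)) (x, y))%E;
    last rewrite (fubini_tonelli _ mF F0).
  apply/esym; rewrite [RHS]integral_mkcond; apply: eq_integral => x _.
  rewrite [RHS]/patch; case: ifPn => xA.
    rewrite [RHS]integral_mkcond; apply: eq_integral => y _.
    rewrite /patch; case: (boolP (y \in B)) => yB.
      by rewrite ifT// inE; split; [rewrite inE in xA|rewrite inE in yB].
    by rewrite ifF//; apply/negbTE; apply: contra yB; rewrite !inE => -[].
  apply: integral0_eq => y _; rewrite /patch ifF//.
  by apply/negbTE; apply: contra xA; rewrite !inE => -[].
rewrite [RHS]integral_mkcond; apply: eq_integral => y _.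
rewrite [RHS]/patch; case: ifPn => yB.
  rewrite [RHS]integral_mkcond; apply: eq_integral => x _.
  rewrite /patch; case: (boolP (x \in A)) => xA.
    by rewrite ifT// inE; split; [rewrite inE in xA|rewrite inE in yB].
  by rewrite ifF//; apply/negbTE; apply: contra xA; rewrite !inE => -[].
apply: integral0_eq => x _; rewrite /patch ifF//.
by apply/negbTE; apply: contra yB; rewrite !inE => -[].
Qed.

Lemma measurable_fun_integral_on d1 d2 (S1 : measurableType d1)
    (S2 : measurableType d2) (m2 : {sigma_finite_measure set S2 -> \bar R})
    (B : set S2) (f : S1 * S2 -> \bar R) :
  measurable B -> measurable_fun [set: S1 * S2] f -> (forall z, 0 <= f z)%E ->
  measurable_fun [set: S1] (fun x => \int[m2]_(y in B) f (x, y))%E.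
Proof.
move=> mB mf f0.
have mF : measurable_fun [set: S1 * S2] (f \_ (setT `*` B)).
  apply/(measurable_restrictT _ _).1; first exact: measurableX.
  exact: measurable_funS mf.
have F0 z : (0 <= (f \_ (setT `*` B)) z)%E by rewrite /patch; case: ifPn.
have := measurable_fun_fubini_tonelli_F (m2 := m2) _ mF F0.
congr (measurable_fun _ _); apply/funext => x.
rewrite /fubini_F [RHS]integral_mkcond; apply: eq_integral => y _.
by rewrite /patch /= in_setX in_setT.
Qed.

Local Notation mu := (@lebesgue_measure R).

(** Typed on both sides with the Borel sigma-algebra that carries the Lebesgue
    measure, as the push-forward requires. *)
Definition translation (a : R) : measurableTypeR R -> measurableTypeR R :=
  fun x => a + x.

Lemma measurable_translation (a : R) :
  measurable_fun [set: measurableTypeR R] (translation a).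
Proof. exact: (measurable_funD (measurable_cst _) (@measurable_id _ _ _)). Qed.

(** A translate of the Lebesgue measure gives intervals their length, hence it
    is the Lebesgue measure. *)
Lemma lebesgue_measure_shift (a : R) (A : set R) : measurable A ->
  pushforward mu (translation a) A = mu A.
Proof.
have ma := measurable_translation a.
move=> mA; apply/esym.
apply: (@lebesgue_measure_unique _
  [the {measure set (measurableTypeR R) -> \bar R} of
    pushforward mu (translation a)]) => //.
move=> _ [[b c]] _ <-.
rewrite /= /pushforward.
have -> : translation a @^-1` `]b, c]%classic = `](b - a), (c - a)]%classic.
  by apply/seteqP; split=> x; rewrite /translation/= !in_itv/=; lra.
rewrite !lebesgue_measure_itv/= !lte_fin ltrD2r; case: ifPn => // _.
by rewrite -!EFinD opprD opprK; congr (_%:E); ring.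
Qed.

Lemma ge0_integral_shift (a : R) (A : set R) (f : R -> \bar R) :
  measurable A -> measurable_fun [set: R] f -> (forall x, 0 <= f x)%E ->
  (\int[mu]_(y in A) f y = \int[mu]_(s in [set s | A (a + s)%R]) f (a + s)%R)%E.
Proof.
move=> mA mf f0.
have ma := measurable_translation a.
transitivity (\int[pushforward mu (translation a)]_(y in A) f y)%E.
  apply: eq_measure_integral => B mB _.
  exact: (esym (lebesgue_measure_shift a mB)).
have mfA : measurable_fun A f by exact: measurable_funS mf.
exact: (ge0_integral_pushforward ma mu mA mfA (fun y _ => f0 y)).
Qed.

End averages_and_translations.

(** * Approximation by step functions *)

Section step_functions.
Context {R : realType}.
Local Notation mu := (@lebesgue_measure R).

Definition cell (r : R) (i : nat) : set R := `[i%:R * r, i.+1%:R * r[.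

Definition cell_mean (r : R) (f : R -> R) (i : nat) : R :=
  r^-1 * \int[mu]_(y in cell r i) f y.

Definition step (N : nat) (r : R) (c : 'I_N -> R) (x : R) : R :=
  \sum_(i < N) c i * \1_(cell r i) x.

Lemma measurable_cell r i : measurable (cell r i).
Proof. exact: measurable_itv. Qed.

Lemma measurable_step N r (c : 'I_N -> R) : measurable_fun [set: R] (step r c).
Proof.
apply: measurable_sum => i; apply: measurable_funM => //.
by apply: measurable_indic; exact: measurable_cell.
Qed.

Lemma cell_inj r i j x : 0 < r -> cell r i x -> cell r j x -> i = j.
Proof.
move=> r0; rewrite /cell /= !in_itv/= => /andP[ix xi] /andP[jx xj].
have := le_lt_trans ix xj; have := le_lt_trans jx xi.
by rewrite !ltr_pM2r// !ltr_nat !ltnS => ji ij; apply/eqP; rewrite eqn_leq ij.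
Qed.

Lemma step_cell N r (c : 'I_N -> R) (i : 'I_N) x : 0 < r ->
  cell r i x -> step r c x = c i.
Proof.
move=> r0 ix; rewrite /step (bigD1 i)//= big1 ?addr0.
  by rewrite indicE mem_set// mulr1.
move=> j ji; rewrite indicE memNset ?mulr0// => jx.
by move/eqP: ji; apply; apply: val_inj; exact: cell_inj r0 jx ix.
Qed.

Lemma cell_cover (N : nat) (T x : R) : (0 < N)%N -> 0 < T -> 0 < x -> x < T ->
  exists i : 'I_N, cell (T / N%:R) i x.
Proof.
move=> N0 T0 x0 xT; have Nr0 : 0 < N%:R :> R by rewrite ltr0n.
have r0 : 0 < T / N%:R by rewrite divr_gt0.
have y0 : 0 <= x / (T / N%:R) by rewrite divr_ge0 ?ltW.
have /andP[y1 y2] := truncn_itv y0.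
have yN : (Num.truncn (x / (T / N%:R)) < N)%N.
  rewrite -(ltr_nat R) (le_lt_trans y1)// ltr_pdivrMr// mulrCA divff ?gt_eqF//.
  by rewrite mulr1.
exists (Ordinal yN); rewrite /cell/= in_itv/=.
by rewrite -ler_pdivlMr// y1/= -ltr_pdivrMr.
Qed.

Lemma cell_mean_le (T r M : R) (f : R -> R) i :
  0 < r -> mu.-integrable [set: R] (EFin \o f) ->
  (\int[mu]_y `|f y|%:E <= M%:E)%E -> `|cell_mean r f i| <= r^-1 * M.
Proof.
move=> r0 intf fM; rewrite /cell_mean normrM gtr0_norm ?invr_gt0//.
rewrite ler_wpM2l ?invr_ge0 ?(ltW r0)//.
have intc : mu.-integrable (cell r i) (EFin \o f).
  by apply: (@integrableS _ _ _ _ setT) => //; exact: measurable_cell.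
apply: (@le_trans _ _ (\int[mu]_(y in cell r i) `|f y|)).
  apply: le_normr_Rintegral => //; exact: measurable_cell.
rewrite -lee_fin fineK; last first.
  apply: integrable_fin_num; first exact: measurable_cell.
  exact: (integrable_norm intc).
apply: le_trans fM; apply: ge0_subset_integral => //.
  exact: measurable_cell.
apply/measurable_EFinP; apply: measurableT_comp => //.
by have /measurable_EFinP := measurable_int mu intf.
Qed.

Context {T p beta : R} {omega : weight R}.
Hypotheses (T0 : 0 < T) (p1 : 1 < p) (wA : Aplus p omega).
Local Notation nm := (morrey_norm T p beta omega).

Lemma measurable_fun_diff_powR (f : R -> R) : measurable_fun [set: R] f ->
  measurable_fun [set: R * R] (fun z => (`|f (z.1 + z.2) - f z.1| `^ p)%:E).
Proof.
move=> mf; apply: measurable_fun_normr_powR; apply: measurable_funB.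
  apply: (measurableT_comp mf); exact: measurable_funD.
exact: (measurableT_comp mf).
Qed.

(** Tonelli exchanges the two integrals; for each s the inner one is then a
    window integral of a difference of translates, and is at most eps^p times
    the weighted size of the window. The factor 2 r is the length of the
    interval of translations. *)
Lemma integral_translates_le (f : R -> R) (r eps : R) :
  measurable_fun [set: R] f -> 0 < r -> 0 <= eps ->
  (forall l, `|l| < r -> (nm (fun x => f (x + l) - f x)%R <= eps%:E)%E) ->
  forall x0 h, 0 <= x0 -> x0 <= T -> 0 < h -> h <= T ->
  (\int[mu]_(x in window T x0 h) \int[mu]_(s in `](- r)%R, r[)
      (`|f (x + s) - f x| `^ p)%R%:E <=
   ((eps `^ p * (h `^ (beta - 1) * mass omega (x0 - h) x0)) * (2 * r))%:E)%E.
Proof.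
move=> mf r0 eps0 fl x0 h x00 x0T h0 hT.
have mphi := measurable_fun_diff_powR mf.
have phi0 (z : R * R) : (0 <= (`|f (z.1 + z.2) - f z.1| `^ p)%:E)%E.
  by rewrite lee_fin powR_ge0.
rewrite (fubini_tonelli_on mu mu (@measurable_window _ T x0 h)
  (measurable_itv _) mphi phi0).
set C := eps `^ p * _.
apply: (@le_trans _ _ (\int[mu]_(s in `](- r)%R, r[) C%:E)%E).
  apply: ge0_le_integral => //.
  - by move=> s _; apply: integral_ge0 => x _; exact: (phi0 (x, s)).
  - have := measurable_fun_integral_on mu (@measurable_window _ T x0 h)
      (measurableT_comp mphi (@measurable_swap _ _ R R)) (fun z => phi0 _).
    exact: measurable_funS.
  move=> s; rewrite /= in_itv/= => sr.
  have /fl : `|s| < r by rewrite ltr_norml.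
  by move/(morrey_normP p1 wA (fun x => f (x + s) - f x) eps0); exact.
rewrite integral_cst//= lebesgue_measure_itv/= lte_fin gtrN// -EFinD -EFinM.
by rewrite opprK lee_fin -mulr2n -[r *+ 2]mulr_natl.
Qed.

(** For x in a cell of length r = T / N, Jensen bounds |f(x) - mean|^p by the mean over the cell of
    |f(x) - f(y)|^p; every y there is x + s with |s| < r, so this is at most
    1/r times the integral of |f(x + s) - f(x)|^p over |s| < r. Integrating in
    x over a window and using Tonelli gives a factor (2 r)/r = 2. *)
Lemma morrey_norm_sub_step_le (f : R -> R) (N : nat) (eps : R) :
  (0 < N)%N -> 0 <= eps ->
  measurable_fun [set: R] f -> mu.-integrable [set: R] (EFin \o f) ->
  (forall l, `|l| < T / N%:R ->
    (nm (fun x => f (x + l) - f x)%R <= eps%:E)%E) ->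
  (nm (fun x => f x - step (T / N%:R)
         (fun i : 'I_N => cell_mean (T / N%:R) f i) x)%R <=
   (2 `^ p^-1 * eps)%:E)%E.
Proof.
move=> N0 eps0 mf intf fl; set r := T / N%:R.
have r0 : 0 < r by rewrite divr_gt0 ?ltr0n.
have p0 : 0 < p by rewrite (lt_trans ltr01).
have mphi := measurable_fun_diff_powR mf.
have phi0 (z : R * R) : (0 <= (`|f (z.1 + z.2) - f z.1| `^ p)%:E)%E.
  by rewrite lee_fin powR_ge0.
apply/(morrey_normP p1 wA _); first by rewrite mulr_ge0 ?powR_ge0.
move=> x0 h x00 x0T h0 hT.
have minner : measurable_fun [set: R]
    (fun x => \int[mu]_(s in `](- r)%R, r[) (`|f (x + s) - f x| `^ p)%R%:E)%E.
  exact: (measurable_fun_integral_on mu (measurable_itv `]- r, r[) mphi phi0).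
apply: (@le_trans _ _ (\int[mu]_(x in window T x0 h) ((r^-1)%:E *
    \int[mu]_(s in `](- r)%R, r[) (`|f (x + s) - f x| `^ p)%R%:E))%E).
  apply: ge0_le_integral.
  - exact: measurable_window.
  - by move=> x _; rewrite lee_fin powR_ge0.
  - apply: measurable_fun_normr_powR.
    by apply: measurable_funS (measurable_funB mf (measurable_step r _)).
  - apply: measurable_funS (measurable_funeM _ minner) => //.
  move=> x [_]; rewrite /= in_itv/= => /andP[xp xT].
  have [i] := cell_cover N0 T0 xp xT; rewrite -/r => ix.
  rewrite (step_cell _ r0 ix).
  have muc : mu (cell r i) = r%:E.
    rewrite lebesgue_measure_itv/= lte_fin ltr_pM2r// ltr_nat ltnSn.
    by rewrite -EFinD -mulrBl -natrB// subSnn mul1r.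
  have intc : mu.-integrable (cell r i) (EFin \o f).
    by apply: (@integrableS _ _ _ _ setT) => //; exact: measurable_cell.
  apply: (@le_trans _ _ ((r^-1)%:E *
      \int[mu]_(y in cell r i) (`|f x - f y| `^ p)%R%:E)%E).
    apply: (@powR_average_le R _ (measurableTypeR R) mu (cell r i) f p r
      (f x)) => //.
    exact: measurable_cell.
  apply: lee_wpmul2l; first by rewrite lee_fin invr_ge0 ltW.
  rewrite (ge0_integral_shift x (measurable_cell r i)); last 2 first.
  - apply: measurable_fun_normr_powR.
    exact: (measurable_funB (measurable_cst _) mf).
  - by move=> y; rewrite lee_fin powR_ge0.
  (* Seen from x, its cell is contained in ]- r, r[. *)
  under eq_integral do rewrite distrC.
  apply: ge0_subset_integral => //.
  - have -> : [set s | cell r i (x + s)] =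
        `[i%:R * r - x, i.+1%:R * r - x[%classic.
      by apply/seteqP; split=> s; rewrite /cell/= !in_itv/= lerBlDl ltrBrDl.
    exact: measurable_itv.
  - apply: measurable_fun_normr_powR.
    apply: (measurable_funS measurableT) => //.
    apply: measurable_funB => //; apply: (measurableT_comp mf).
    exact: measurable_funD.
  move=> s; move: ix; rewrite /cell/= !in_itv/=.
  rewrite -[in i.+1%:R]addn1 natrD mulrDl mul1r => /andP[? ?] /andP[? ?].
  by apply/andP; split; lra.
rewrite ge0_integralZl//; last 4 first.
- exact: measurable_window.
- exact: measurable_funS minner.
- by move=> x _; apply: integral_ge0 => s _; exact: (phi0 (x, s)).
- by rewrite lee_fin invr_ge0 ltW.
rewrite lee_pdivrMl//;
apply: (le_trans (integral_translates_le mf r0 eps0 fl x00 x0T h0 hT)).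
rewrite -EFinM lee_fin powRM ?powR_ge0// -powRrM mulVf ?gt_eqF// powRr1//.
by rewrite le_eqVlt; apply/orP; left; apply/eqP; ring.
Qed.

End step_functions.

(** * Total boundedness and precompactness *)

Section total_boundedness.

Lemma ultra_bigcup_fin (T : Type) (F : set_system T) (I : finType)
    (A : I -> set T) : UltraFilter F -> F (\bigcup_i A i) -> exists i, F (A i).
Proof.
move=> FU FA; apply: contrapT => /forallNP nF.
have FC (s : seq I) : F (\bigcap_(i in [set` s]) ~` A i).
  elim: s => [|i s IH]; first by apply: filterS filterT => x _ j.
  have [/(nF i)//|Fi] := in_ultra_setVsetC (A i) FU.
  apply: filterS (filterI Fi IH) => x [nAi nAs] j /=.
  by rewrite inE => /predU1P[->//|]; exact: nAs.
have [x [[i _ Aix] nA]] := filter_ex (filterI FA (FC (enum I))).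
by apply: (nA i) => //=; rewrite mem_enum.
Qed.

Context {R : realType} {V : normedModType R}.

Lemma fast_cauchy_dist (u : nat -> V) :
  (forall n, `|u n.+1 - u n| <= 2^-1 ^+ n) ->
  forall n k, `|u n - u (n + k)%N| <= 2 * 2^-1 ^+ n.
Proof.
move=> uC n k.
suff : `|u n - u (n + k)%N| <= 2 * 2^-1 ^+ n - 2 * 2^-1 ^+ (n + k).
  have : 0 < 2^-1 ^+ (n + k) :> R by rewrite exprn_gt0.
  lra.
elim: k => [|k IH]; first by rewrite addn0 !subrr normr0.
rewrite addnS exprS.
have := ler_normD (u n - u (n + k)%N) (u (n + k)%N - u (n + k).+1).
by rewrite addrA subrK (distrC (u (n + k)%N)); have := uC (n + k)%N; lra.
Qed.

(** Total boundedness in the form that a pigeonhole argument produces: finitely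
    many pieces of diameter at most e, without centres. *)
Definition totally_bounded (G : set V) := forall e : R, 0 < e ->
  exists (I : finType) (k : V -> I),
    forall f g, G f -> G g -> k f = k g -> `|f - g| <= e.

(** Completeness tested on the sequences with geometrically small steps, which
    is enough in a metric space: a Cauchy filter contains balls of
    radius 2^-(n + 1) around points that form such a sequence. *)
Definition fast_cauchy_complete := forall u : nat -> V,
  (forall n, `|u n.+1 - u n| <= 2^-1 ^+ n) ->
  exists v, forall n, `|u n - v| <= 2 * 2^-1 ^+ n.

Lemma half_expn_lt (e : R) : 0 < e -> exists n, 2^-1 ^+ n < e :> R.
Proof.
move=> e0; have h1 : `|2^-1 : R| < 1 by rewrite ger0_norm//; lra.
have /cvgr_dist_lt/(_ e e0) [n _ /(_ n (leqnn n))] := cvg_expr h1.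
by rewrite /= sub0r normrN ger0_norm ?exprn_ge0//; exists n.
Qed.

(** An ultrafilter on the closure of G contains one of the finitely many pieces
    that cover it, so it contains arbitrarily small balls. Choosing such balls
    with radii 2^-(n + 1) gives a sequence of centres with geometrically small
    steps (two members of the ultrafilter meet), whose limit is the limit of
    the ultrafilter. *)
Lemma precompact_totally_bounded (G : set V) :
  fast_cauchy_complete -> totally_bounded G -> precompact G.
Proof.
move=> cV tG; rewrite precompactE compact_ultra => F FU FG.
have small (e : R) : 0 < e -> exists x, F (ball x e).
  move=> e0; have e40 : 0 < e / 4 by rewrite divr_gt0.
  have [I [k kG]] := tG _ e40.
  pose A i : set V := [set y | exists2 g, G g & k g = i /\ `|y - g| < e / 4].
  have cGA : closure G `<=` \bigcup_i A i.
    move=> y /(_ (ball y (e / 4)) (nbhsx_ballx _ _ e40)) [g [Gg yg]].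
    by exists (k g) => //; exists g => //; split=> //; rewrite -ball_normE in yg.
  have [i Fi] := ultra_bigcup_fin FU (filterS cGA FG).
  have [x [g Gg [gi xg]]] := filter_ex Fi.
  exists x; apply: filterS Fi => y [g' Gg' [gi' yg']].
  rewrite -ball_normE /=.
  have gg' : `|g - g'| <= e / 4 by apply: kG => //; rewrite gi gi'.
  have := ler_normD (x - g) (g - y); rewrite addrA subrK.
  have := ler_normD (g - g') (g' - y); rewrite addrA subrK.
  rewrite (distrC g' y); lra.
have h0 n : 0 < 2^-1 ^+ n :> R by rewrite exprn_gt0.
have /choice[u Fu] : forall n, exists x, F (ball x (2^-1 ^+ n / 2)).
  by move=> n; apply: small; rewrite divr_gt0.
have [v uv] : exists v, forall n, `|u n - v| <= 2 * 2^-1 ^+ n.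
  apply: cV => n; have [y [yn yn1]] := filter_ex (filterI (Fu n) (Fu n.+1)).
  move: yn yn1; rewrite -!ball_normE/= exprS => yn yn1.
  have := ler_normD (u n.+1 - y) (y - u n); rewrite addrA subrK.
  by rewrite (distrC y); have := h0 n; lra.
have Fv : F --> v.
  move=> B /nbhs_ballP[e /= e0 eB].
  have e30 : 0 < e / 3 by rewrite divr_gt0.
  have [n ne] := half_expn_lt e30.
  apply: filterS (Fu n) => y; rewrite -ball_normE/= => uy; apply: eB.
  rewrite -ball_normE/=.
  have := ler_normD (v - u n) (u n - y); rewrite addrA subrK.
  by rewrite (distrC v (u n)); have := uv n; have := h0 n; lra.
exists v; split=> //.
rewrite ((closure_id (closure G)).1 (@closed_closure _ G)).
move=> B /Fv FB; exact: filter_ex (filterI FG FB).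
Qed.

End total_boundedness.

(** * Completeness of the Morrey space *)

Section fatou_for_powers.
Context {R : realType}.

Lemma limn_einf_ge (u : nat -> \bar R) (c : \bar R) :
  (forall n, c <= u n)%E -> (c <= limn_einf u)%E.
Proof.
move=> cu; rewrite limn_einf_lim; apply: lime_ge; first exact: is_cvg_einfs.
by apply: nearW => n; apply: le_ereal_inf_tmp => _ [k _ <-].
Qed.

Lemma limn_einf_le (u : nat -> \bar R) (c : \bar R) :
  (forall n, u n <= c)%E -> (limn_einf u <= c)%E.
Proof.
move=> uc; rewrite limn_einf_lim; apply: lime_le; first exact: is_cvg_einfs.
apply: nearW => n; apply: (@le_trans _ _ (u n)) => //.
by apply: ereal_inf_lbound; exists n => //=.
Qed.

Lemma cvg_limn_einf_sup_fin (a : nat -> R) (l : R) : a @ \oo --> l ->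
  (limn_einf (fun n => (a n)%:E) = l%:E) *
  (limn_esup (fun n => (a n)%:E) = l%:E).
Proof.
by move=> al; apply: cvg_limn_einf_sup; apply: cvg_EFin => //; exact: nearW.
Qed.

(** Equality holds, by continuity of the power; at the limit 0 the inequality
    is all that is needed and avoids continuity at the boundary point. *)
Lemma powR_le_limn_einf (p : R) (a : nat -> R) (l : R) : 0 < p -> 0 <= l ->
  a @ \oo --> l -> ((l `^ p)%:E <= limn_einf (fun k => (a k `^ p)%:E))%E.
Proof.
move=> p0; rewrite le_eqVlt => /predU1P[<- _|l0 al].
  rewrite powR0 ?gt_eqF//; apply: limn_einf_ge => k.
  by rewrite lee_fin powR_ge0.
have cl : {for l, continuous (@powR R ^~ p)}.
  apply: differentiable_continuous; apply/derivable1_diffP.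
  exact: (@ex_derive _ _ _ _ _ _ _ (is_derive1_powR p l0)).
have ap : (fun k => a k `^ p) @ \oo --> l `^ p.
  exact: (continuous_cvg _ cl al).
by rewrite (cvg_limn_einf_sup_fin ap).
Qed.

(** Fatou's lemma as it serves for completeness: a uniform bound on p-th powers
    passes to almost everywhere limits. *)
Lemma fatou_powR d (S : measurableType d) (mu : {measure set S -> \bar R})
    (D : set S) (p : R) (g : nat -> S -> R) (l : S -> R) (C : \bar R) :
  measurable D -> 0 < p -> (forall n, measurable_fun D (g n)) ->
  measurable_fun D l ->
  {ae mu, forall x, D x -> g n x @[n --> \oo] --> l x} ->
  (forall n, \int[mu]_(x in D) (`|g n x| `^ p)%:E <= C)%E ->
  (\int[mu]_(x in D) (`|l x| `^ p)%:E <= C)%E.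
Proof.
move=> mD p0 mg ml gl gC; have FF := ae_filter_ringOfSetsType mu.
pose G n x := (`|g n x| `^ p)%:E.
have mG n : measurable_fun D (G n) by exact: measurable_fun_normr_powR.
have G0 n x : D x -> (0 <= G n x)%E by rewrite lee_fin powR_ge0.
apply: (@le_trans _ _ (\int[mu]_(x in D) limn_einf (G ^~ x))%E).
  apply: ae_ge0_le_integral => //.
  - exact: measurable_fun_normr_powR.
  - by move=> x Dx; apply: limn_einf_ge => n; exact: G0.
  - apply: measurableT_comp => //; apply: measurable_fun_limn_esup => n.
    exact: measurableT_comp.
  apply: (@filterS _ _ FF _ _ _ gl) => x /[apply] glx.
  by apply: powR_le_limn_einf => //; exact: cvg_norm.
apply: le_trans (limn_einf_le gC); exact: fatou.
Qed.

End fatou_for_powers.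

Section morrey_space.
Context {R : realType} {T p beta : R} {omega : weight R}.
Context {T0 : 0 < T} {p1 : 1 < p} {wA : Aplus p omega}.
Local Notation mu := (@lebesgue_measure R).
Local Notation nm := (morrey_norm T p beta omega).
Local Notation V := (morrey beta T0 p1 wA).
Local Notation F := (morrey_fun beta omega T0 p1).
Local Open Scope quotient_scope.

Lemma fun_of_morreyB (u v : V) : {ae mu,
  forall x, x \in `]0, T[ -> (u - v : V) x = u x - v x}.
Proof.
have FF := ae_filter_ringOfSetsType mu.
have : {ae mu, forall x, x \in `]0, T[ ->
    fun_of_morrey (\pi_V (repr u - repr v)) x = (repr u - repr v : F) x}.
  exact: fun_of_morrey_pi.
have -> : \pi_V (repr u - repr v) = u - v.
  by rewrite -[in RHS](reprK u) -[in RHS](reprK v) [RHS]piE.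
apply: (@filterS _ _ FF) => x H xT; rewrite (H xT).
have E (w : V) : fun_of_morrey w x = (repr w : F) x.
  by rewrite /fun_of_morrey /patch ifT ?inE.
by rewrite (E u) (E v).
Qed.

Lemma morrey_normB (u v : V) : (`|u - v|)%:E = nm (fun x => u x - v x).
Proof.
rewrite morrey_normE; apply: eq_ae_morrey_norm => //.
- exact: measurable_fun_of_morrey.
- by apply: measurable_funB; exact: measurable_fun_of_morrey.
- exact: fun_of_morreyB.
Qed.

Lemma integral_norm_fun_of_morrey (u : V) (M : R) : `|u| <= M ->
  (\int[mu]_y `|u y|%:E <= (M * @L1const R T p beta omega)%:E)%E.
Proof.
move=> uM; have M0 : 0 <= M by exact: le_trans uM.
have uM' : (nm u <= M%:E)%E by rewrite -morrey_normE lee_fin.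
apply: le_trans
  (integral_norm_morrey T0 p1 wA M0 (measurable_fun_of_morrey u) uM').
rewrite [leRHS]integral_mkcond le_eqVlt; apply/orP; left; apply/eqP.
apply: eq_integral => x _; rewrite /fun_of_morrey /patch.
by case: ifPn => // _; rewrite normr0.
Qed.

Lemma integrable_fun_of_morrey (u : V) : mu.-integrable [set: R] (EFin \o u).
Proof.
apply/integrableP; split.
  by apply/measurable_EFinP; exact: measurable_fun_of_morrey.
by apply: le_lt_trans (integral_norm_fun_of_morrey (lexx `|u|)) _; exact: ltry.
Qed.

(** The L^1 norms of the increments are summable, so the sum of their absolute
    values has a finite integral and is finite almost everywhere; there the
    series of increments converges absolutely. *)
Lemma fast_cauchy_ae_cvg (u : nat -> V) :
  (forall n, `|u n.+1 - u n| <= 2^-1 ^+ n) ->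
  {ae mu, forall x, x \in `]0, T[ -> cvgn (fun n => u n x)}.
Proof.
move=> uC; have FF := ae_filter_ringOfSetsType mu.
pose g n x := (`|u n.+1 x - u n x|)%:E.
have mg n : measurable_fun [set: R] (g n).
  apply/measurable_EFinP; apply: measurableT_comp => //.
  by apply: measurable_funB; exact: measurable_fun_of_morrey.
have mgT n : measurable_fun (`]0, T[ : set R) (g n).
  exact: measurable_funS (mg n).
have g0 n x : (0 <= g n x)%E by rewrite lee_fin.
have h1 : `|2^-1 : R| < 1 by rewrite ger0_norm//; lra.
set L := @L1const R T p beta omega.
have L0 : 0 <= L by exact: L1const_ge0.
have gL n : (\int[mu]_(x in `]0%R, T[) g n x <= (geometric L 2^-1 n)%:E)%E.
  rewrite /geometric /= mulrC.
  apply: (integral_norm_morrey T0 p1 wA (f := fun x => u n.+1 x - u n x)).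
  - by rewrite exprn_ge0.
  - by apply: measurable_funB; exact: measurable_fun_of_morrey.
  - by rewrite -morrey_normB lee_fin.
pose G x := (\sum_(n <oo) g n x)%E.
have intG : mu.-integrable `]0, T[ G.
  apply/integrableP; split.
    by apply: ge0_emeasurable_sum => // k _; exact: mgT.
  under eq_integral do rewrite gee0_abs ?nneseries_ge0//.
  rewrite integral_nneseries//.
  apply: (@le_lt_trans _ _ (\sum_(n <oo) (geometric L 2^-1 n)%:E)%E).
    by apply: lee_nneseries => // n _ _; apply: integral_ge0 => x _; exact: g0.
  apply: (@le_lt_trans _ _ (L / (1 - 2^-1))%:E); last exact: ltry.
  apply: lime_le.
    by apply: is_cvg_nneseries => n _ _; rewrite lee_fin mulr_ge0 ?exprn_ge0.
  apply: nearW => n; rewrite sumEFin lee_fin.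
  rewrite -[leLHS]/(series (geometric L 2^-1) n).
  exact: geometric_le_lim.
have := integrable_ae (mu := mu) (measurable_itv `]0, T[) intG.
apply: (@filterS _ _ FF) => x /[swap] xT /(_ xT) Gx.
have : cvgn (series (telescope (fun n => u n x))).
  apply: normed_cvg; apply: nnseries_is_cvg => [k|/=]; first exact: normr_ge0.
  by move: Gx; rewrite ge0_fin_numE// nneseries_ge0.
rewrite telescopeK => /cvg_ex[l ul].
apply/cvg_ex; exists (l + u 0%N x).
have -> : (fun n => u n x) = (fun n => u n x - u 0%N x + u 0%N x).
  by apply/funext => n; rewrite subrK.
exact: (cvgD ul (cvg_cst _)).
Qed.

(** Completeness of the Morrey space. The candidate is the almost everywhere
    limit f; for fixed n, the bound on u n - u (n + k) in each window is uniform
    in k, and Fatou gives the same bound for u n - f. In particular f has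
    finite norm, being within finite distance of u 0. *)
Lemma morrey_fast_cauchy_cvg (u : nat -> V) :
  (forall n, `|u n.+1 - u n| <= 2^-1 ^+ n) ->
  exists v : V, forall n, `|u n - v| <= 2 * 2^-1 ^+ n.
Proof.
move=> uC; have FF := ae_filter_ringOfSetsType mu.
(* The upper limit makes f measurable on the whole line, also where the
   sequence diverges. *)
pose f x : R := fine (limn_esup (fun n => (u n x)%:E)).
have mf : measurable_fun [set: R] f.
  apply: (@measurableT_comp _ _ _ _ _ _ (@fine R)) => //.
  apply: measurable_fun_limn_esup => n.
  by apply/measurable_EFinP; exact: measurable_fun_of_morrey.
have cf : {ae mu, forall x, x \in `]0, T[ -> u n x @[n --> \oo] --> f x}.
  apply: (@filterS _ _ FF _ _ _ (fast_cauchy_ae_cvg uC)) => x /[apply] cx.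
  rewrite /f; have /cvg_ex[l ul] := cx.
  by rewrite (cvg_limn_einf_sup_fin ul).
have uf n : (nm (fun x => u n x - f x)%R <= (2 * 2^-1 ^+ n)%:E)%E.
  apply/(morrey_normP p1 wA); first by rewrite mulr_ge0 ?exprn_ge0.
  move=> x0 h x00 x0T h0 hT.
  apply: (@fatou_powR _ _ _ mu _ p (fun k x => u n x - u (n + k)%N x)).
  - exact: measurable_window.
  - exact: lt_trans p1.
  - move=> k; apply: (measurable_funS measurableT) => //.
    by apply: measurable_funB; exact: measurable_fun_of_morrey.
  - apply: (measurable_funS measurableT) => //.
    by apply: measurable_funB => //; exact: measurable_fun_of_morrey.
  - apply: (@filterS _ _ FF _ _ _ cf) => x + [_ xT] => /(_ xT) H.
    apply: cvgB; first exact: cvg_cst.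
    under eq_fun do rewrite addnC.
    by move: H; rewrite -(cvg_shiftn n).
  move=> k; move: x0 h x00 x0T h0 hT.
  apply/(morrey_normP p1 wA _); first by rewrite mulr_ge0 ?exprn_ge0.
  by rewrite -morrey_normB lee_fin; exact: fast_cauchy_dist.
have [v vf] : exists v : V, {ae mu, forall x, x \in `]0, T[ -> v x = f x}.
  apply: morrey_exists => //.
  have -> : f = (fun x => u 0%N x) \+ (fun x => -1 *: (u 0%N x - f x)).
    by apply/funext => x /=; rewrite scaleN1r opprB addrC subrK.
  have mu0 := measurable_fun_of_morrey (u 0%N).
  have mD : measurable_fun [set: R] (fun x => u 0%N x - f x).
    exact: measurable_funB.
  have mN : measurable_fun [set: R] (fun x => -1 *: (u 0%N x - f x)).
    exact: (measurable_funM (measurable_cst _) mD).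
  apply: le_lt_trans (ler_morrey_normD _ _ _ p1 mu0 mN) _.
  apply: lte_add_pinfty; first exact: fun_of_morrey_lty.
  rewrite (morrey_normZ beta omega T0 p1 (-1) mD).
  by rewrite normrN1 mul1e (le_lt_trans (uf 0%N))// ltry.
exists v => n; rewrite -lee_fin morrey_normB; apply: le_trans (uf n).
rewrite le_eqVlt; apply/orP; left; apply/eqP; apply: eq_ae_morrey_norm => //.
- by apply: measurable_funB; exact: measurable_fun_of_morrey.
- by apply: measurable_funB => //; exact: measurable_fun_of_morrey.
by apply: (@filterS _ _ FF _ _ _ vf) => x /[apply] ->.
Qed.

End morrey_space.

(** * Total boundedness in the Morrey space *)

Section compactness_criterion.
Context {R : realType} {T p beta : R} {omega : weight R}.
Context {T0 : 0 < T} {p1 : 1 < p} {wA : Aplus p omega}.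
Local Notation mu := (@lebesgue_measure R).
Local Notation nm := (morrey_norm T p beta omega).
Local Notation V := (morrey beta T0 p1 wA).

Lemma eq_truncn_dist (x y : R) : 0 <= x -> 0 <= y ->
  Num.truncn x = Num.truncn y -> `|x - y| <= 1.
Proof.
move=> /truncn_itv/andP[x1 x2] /truncn_itv/andP[y1 y2] xy.
rewrite ler_norml; move: x1 x2 y1 y2; rewrite xy -natr1; lra.
Qed.

(** Round each coordinate, shifted by B to be nonnegative, to a multiple of
    eta. *)
Lemma bounded_family_buckets (S : Type) (G : set S) (N : nat)
    (c : S -> 'I_N -> R) (B eta : R) : 0 < eta -> 0 <= B ->
  (forall f i, G f -> `|c f i| <= B) ->
  exists (I : finType) (k : S -> I), forall f g, G f -> G g -> k f = k g ->
    forall i, `|c f i - c g i| <= eta.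
Proof.
move=> eta0 B0 cB.
pose J := Num.truncn ((B + B) / eta).
pose q f i := (c f i + B) / eta.
exists {ffun 'I_N -> 'I_J.+1},
  (fun f => [ffun i => inord (Num.truncn (q f i))]).
have q0 f i : G f -> 0 <= q f i.
  move=> Gf; rewrite divr_ge0 ?(ltW eta0)//.
  by have := cB f i Gf; rewrite ler_norml => /andP[+ _]; lra.
have qJ f i : G f -> (Num.truncn (q f i) < J.+1)%N.
  move=> Gf; rewrite ltnS; apply: le_truncn.
  rewrite ler_pM2r ?invr_gt0// lerD2r.
  by have := cB f i Gf; rewrite ler_norml => /andP[].
move=> f g Gf Gg /ffunP kfg i; have := kfg i; rewrite !ffunE => /(congr1 val)/=.
rewrite !inordK ?qJ// => /eq_truncn_dist => /(_ (q0 f i Gf) (q0 g i Gg)).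
rewrite /q -mulrBl opprD addrACA subrr addr0 normrM.
by rewrite [X in _ * X]gtr0_norm ?invr_gt0// ler_pdivrMr// mul1r.
Qed.

(** Replace each member of G by the step function of its means on N cells
    shorter than d. The error is e / 3, the means are bounded uniformly over G
    because the Morrey norm controls the L^1 norm, and step functions with
    nearby coefficients are close in Morrey norm because they are uniformly
    close. So it is enough to sort the vectors of means. *)
Lemma morrey_totally_bounded (G : set V) (M : R) : p + beta <= 2 ->
  (forall f, G f -> `|f| <= M) ->
  (forall e, 0 < e -> exists2 d, 0 < d & forall (f : V) l, G f -> `|l| < d ->
    (nm (fun x => f (x + l) - f x)%R <= e%:E)%E) ->
  totally_bounded G.
Proof.
move=> pb GM Geq e e0.
have p0 : 0 < p by exact: lt_trans p1.
have [K K0 bK] := morrey_norm_bounded (beta := beta) T0 p1 wA pb.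
have c20 : 0 < 2 `^ p^-1 :> R by rewrite powR_gt0.
have e30 : 0 < e / 3 by rewrite divr_gt0.
have [d d0 Gd] := Geq (e / 3 / 2 `^ p^-1) (divr_gt0 e30 c20).
pose N := (Num.truncn (T / d)).+1.
have Nr0 : 0 < N%:R :> R by rewrite ltr0n.
set r := T / N%:R; have r0 : 0 < r by rewrite divr_gt0.
have rd : r < d.
  rewrite ltr_pdivrMr// mulrC -ltr_pdivrMr//.
  have Td0 : 0 <= T / d by rewrite divr_ge0 ?ltW.
  by have /andP[] := truncn_itv Td0.
set B := r^-1 * (`|M| * @L1const R T p beta omega).
have B0 : 0 <= B.
  by rewrite mulr_ge0 ?invr_ge0 ?(ltW r0)// mulr_ge0// L1const_ge0.
have cB (f : V) (i : 'I_N) : G f -> `|cell_mean r f i| <= B.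
  move=> Gf; apply: cell_mean_le => //; first exact: integrable_fun_of_morrey.
  by apply: integral_norm_fun_of_morrey; exact: le_trans (GM f Gf) (ler_norm M).
have eta0 : 0 < e / 3 / K by rewrite divr_gt0.
have [I [k kG]] := bounded_family_buckets
  (c := fun (f : V) (i : 'I_N) => cell_mean r f i) eta0 B0 cB.
exists I, k;
suff : forall f g : V, G f -> G g -> k f = k g -> `|f - g| <= e by [].
move=> f g Gf Gg kfg.
pose s (u : V) := step r (fun i : 'I_N => cell_mean r u i).
have ms u : measurable_fun [set: R] (s u) by exact: measurable_step.
have mV (u : V) : measurable_fun [set: R] u by exact: measurable_fun_of_morrey.
have us (u : V) : G u -> (nm (fun x => u x - s u x)%R <= (e / 3)%:E)%E.
  move=> Gu.
  have -> : e / 3 = 2 `^ p^-1 * (e / 3 / 2 `^ p^-1) by field; exact: lt0r_neq0.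
  apply: morrey_norm_sub_step_le => //.
  - by rewrite divr_ge0 ?(ltW e30)// ltW.
  - exact: integrable_fun_of_morrey.
  - by move=> l lr; apply: Gd => //; exact: lt_trans rd.
have su (u : V) : G u -> (nm (fun x => s u x - u x)%R <= (e / 3)%:E)%E.
  move=> /us/(morrey_normP p1 wA _ (ltW e30)) H.
  apply/(morrey_normP p1 wA _ (ltW e30)).
  move=> x0 h x00 x0T h0 hT; apply: le_trans (H x0 h x00 x0T h0 hT).
  by under eq_integral do rewrite distrC.
have ss : (nm (fun x => s f x - s g x)%R <= (e / 3)%:E)%E.
  have -> : e / 3 = K * (e / 3 / K) by field; exact: lt0r_neq0.
  apply: bK; [exact: measurable_funB|exact: ltW|move=> x xp xT].
  have [i ix] := cell_cover (N := N) isT T0 xp xT.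
  by rewrite /s !(step_cell _ r0 ix); exact: kG.
rewrite -lee_fin morrey_normB.
have -> : (fun x => f x - g x) =
    (fun x => f x - s f x) \+
    ((fun x => s f x - s g x) \+ (fun x => s g x - g x)).
  by apply/funext => x /=; ring.
have -> : e = e / 3 + (e / 3 + e / 3) by field.
rewrite EFinD [X in (_ + X)%E]EFinD.
apply: (le_trans (ler_morrey_normD _ _ _ p1 _ _)).
- exact: measurable_funB.
- apply: measurable_funD; exact: measurable_funB.
apply: leeD; first exact: us.
apply: (le_trans (ler_morrey_normD _ _ _ p1 _ _)).
- exact: measurable_funB.
- exact: measurable_funB.
apply: leeD; [exact: ss|exact: su].
Qed.

Lemma ereal_sup_ge0_ge (A : set (\bar R)) (z : \bar R) :
  A z -> (z <= ereal_sup_ge0 A)%E.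
Proof. by move=> Az; apply: ereal_sup_ubound; right. Qed.

End compactness_criterion.

Theorem theorem3p3 (R : realType) (T p beta : R) (omega : weight R)
    (T0 : 0 < T) (p1 : 1 < p) (beta0 : 0 <= beta) (beta1 : beta < 1)
    (pbeta : p + beta <= 2) (wA : Aplus p omega)
    (G : set (morrey beta T0 p1 wA)) :
  (ereal_sup_ge0 [set `|f|%:E | f in G] < +oo)%E ->
  ereal_sup_ge0 [set morrey_norm T p beta omega (fun x => f (x + l) - f x)
                | f in G] @[l --> (0 : R)] --> 0%E ->
  ereal_sup_ge0 [set morrey_norm T p beta omega
                       (fun x => f x * \1_(`]0, T[ `&` [set y | r < y]) x)
                | f in G] @[r --> T^'-] --> 0%E ->
  precompact G.
Proof.
move=> Gbd Geq _.
apply: precompact_totally_bounded; first exact: morrey_fast_cauchy_cvg.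
have [M GM] : exists M : R, forall f, G f -> `|f| <= M.
  move: Gbd; set S := ereal_sup_ge0 _ => Soo.
  have S0 : (0 <= S)%E by apply: ereal_sup_ubound; left.
  have Sfin : S \is a fin_num by rewrite ge0_fin_numE.
  exists (fine S) => f Gf; rewrite -lee_fin (fineK Sfin).
  by apply: ereal_sup_ge0_ge; exists f.
apply: (morrey_totally_bounded pbeta GM) => e e0.
have H : nbhs 0%E [set z : \bar R | (z < e%:E)%E].
  by apply: open_ereal_lt'; rewrite lte_fin.
have /nbhs_ballP[d /= d0 dG] := Geq _ H.
exists d => // f l Gf ld.
apply: le_trans (ltW (dG l _)).
  by apply: ereal_sup_ge0_ge; exists f.
by rewrite -ball_normE /= sub0r normrN.
Qed.
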